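(* Let $V$ be an infinity algebra (either an $A_\infty$ algebra or an $L_\infty$ algebra) over a field $\mathbf{k}$ of characteristic different from $2$, with codifferential $d$. Let $S$ be a finite-dimensional $\mathbb{Z}_2$-graded commutative $\mathbf{k}$-algebra with identity and with a distinguished maximal ideal $\mathfrak{m}\subset S$ such that $S/\mathfrak{m}\cong\mathbf{k}$. Let $F=\mathfrak{m}^*$ with the comultiplication $\Delta$ dual to the multiplication of $\mathfrak{m}$, let $F_0=(\mathfrak{m}/\mathfrak{m}^2)^*\subset F$ and $F_1=F$, and let $H(V)$ be the cohomology of the differential graded Lie algebra $C(V)$. Then an infinitesimal deformation of $V$ with base $S$, i.e. a linear map $a\colon F_0\to H(V)$, is the differential of some deformation of $V$ with base $S$ if and only if $-\tfrac12 a$ satisfies the condition of triviality of Massey $F$-products.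
   Context: **Cochains and brackets.** $V$ is a $\mathbb{Z}_2$-graded vector space over $\mathbf{k}$. Inside an exponent of $-1$, a homogeneous element or map stands for its $\mathbb{Z}_2$-degree. $A_\infty$ case: $C^k(V)=\mathrm{Hom}(V^{\otimes k},V)$, $C(V)=\prod_{k\ge1}C^k(V)$. For $\varphi\in C^k(V)$, $\psi\in C^l(V)$, $n=k+l-1$, $$[\varphi,\psi](v_1,\dots,v_n)=\sum_{0\le j\le k-1}(-1)^{r}\varphi(v_1,\dots,v_j,\psi(v_{j+1},\dots,v_{j+l}),v_{j+l+1},\dots,v_n)-(-1)^{\varphi\psi+(k-1)(l-1)}\sum_{0\le j\le l-1}(-1)^{s}\psi(v_1,\dots,v_j,\varphi(v_{j+1},\dots,v_{j+k}),v_{j+k+1},\dots,v_n),$$ with $r=\psi(v_1+\cdots+v_j)+j(l-1)$ and $s=\varphi(v_1+\cdots+v_j)+j(k-1)$. $L_\infty$ case: $C^k(V)=\mathrm{Hom}(\bigwedge^kV,V)$, $C(V)=\prod_{k\ge1}C^k(V)$, where $\bigwedge$ is the graded exterior power ($v\wedge w=-(-1)^{vw}w\wedge v$). Define $\epsilon(\sigma)=\epsilon(\sigma;v_1,\dots,v_n)$ by $v_1\wedge\cdots\wedge v_n=(-1)^\sigma\epsilon(\sigma)\,v_{\sigma(1)}\wedge\cdots\wedge v_{\sigma(n)}$, with $(-1)^\sigma$ the sign of $\sigma$; $\mathrm{Sh}(p,q)$ is the set of permutations of $\{1,\dots,p+q\}$ increasing on $1,\dots,p$ and on $p+1,\dots,p+q$.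 Then $$[\varphi,\psi](v_1,\dots,v_n)=\sum_{\sigma\in \mathrm{Sh}(l,k-1)}(-1)^\sigma\epsilon(\sigma)\,\varphi(\psi(v_{\sigma(1)},\dots,v_{\sigma(l)}),v_{\sigma(l+1)},\dots,v_{\sigma(n)})-(-1)^{\psi\varphi+(k-1)(l-1)}\sum_{\sigma\in \mathrm{Sh}(k,l-1)}(-1)^\sigma\epsilon(\sigma)\,\psi(\varphi(v_{\sigma(1)},\dots,v_{\sigma(k)}),v_{\sigma(k+1)},\dots,v_{\sigma(n)}).$$ In both cases the modified bracket is $\{\varphi,\psi\}=(-1)^{(k-1)|\psi|}[\varphi,\psi]$ for $\varphi\in C^k(V)$ and $\psi$ of $\mathbb{Z}_2$-degree $|\psi|$, extended to all of $C(V)$. The parity of $\varphi\in C^k(V)$ of $\mathbb{Z}_2$-degree $|\varphi|$ is $|\varphi|+k-1 \bmod 2$; with this parity $(C(V),\{\cdot,\cdot\})$ is a graded Lie algebra. **Infinity algebras.** An $A_\infty$ (resp. $L_\infty$) structure on $V$ is an odd $d=\sum_{k\ge1}d_k\in C(V)$, $d_k\in C^k(V)$ (so $d_k$ has $\mathbb{Z}_2$-degree $k \bmod 2$), with $\{d,d\}=0$; $d$ is called its codifferential. Then $\delta(\varphi)=\{d,\varphi\}$ makes $C(V)$ a differential graded Lie algebra (with bracket $\mu(u,v)=\{u,v\}$); $H(V)$ is its cohomology. An infinity algebra structure over $S$ on an $S$-module is defined in the same way with $S$-multilinear maps (tensor/exterior powers over $S$, scalars being moved to the right with the usual sign $(-1)^{sv}$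 for passing $s$ across $v$). **Deformations with base.** Let $\varepsilon\colon S\to S/\mathfrak{m}=\mathbf{k}$ be the projection, $\varepsilon(1)=1$. A deformation of $V$ with base $S$ is an infinity algebra structure $\tau=\sum_n\tau_n$ over $S$ (of the same type as $V$) on $V\otimes S$ such that $1\otimes\varepsilon\colon V\otimes S\to V$ is an infinity algebra homomorphism, i.e. $$(1\otimes\varepsilon)\tau_n(v_1\otimes s_1,\dots,v_n\otimes s_n)=d_n(v_1,\dots,v_n)\,\varepsilon(s_1\cdots s_n).$$ Such $\tau$ determines a linear map $\alpha\colon\mathfrak{m}^*\to C(V)$ by $$\alpha(\varphi)(v_1,\dots,v_k)=(1\otimes\varphi)\big(\tau_k(v_1\otimes1,\dots,v_k\otimes1)-d_k(v_1,\dots,v_k)\big),\qquad \varphi\in\mathfrak{m}^*,$$ where $(1\otimes\varphi)(w\otimes m)=(-1)^{\varphi w}w\,\varphi(m)$. The comultiplication $\Delta$ on $F=\mathfrak{m}^*$: if $\{m_i\}$ is a homogeneous basis of $\mathfrak{m}$ with dual basis $\{m^i\}$ and $m_im_j=\sum_kc_{ij}^km_k$, then $\Delta m^k=\sum_{i,j}(-1)^{m_im_j}c_{ij}^k\,m^i\otimes m^j$. $F_0=(\mathfrak{m}/\mathfrak{m}^2)^*$ is regarded as a subspace of $F$; then $F_0\subset\ker\Delta$. For a deformation $\tau$, $\alpha(F_0)\subset\ker\delta$, and the composition $F_0\xrightarrow{\alpha}\ker\delta\xrightarrow{\pi}H(V)$, with $\pi$ the projection to cohomology, is called the differential of the deformation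 $\tau$. An infinitesimal deformation with base $S$ is any linear map $F_0\to H(V)$. **Triviality of Massey $F$-products.** A linear map $a'\colon F_0\to H(V)$ satisfies the condition of triviality of Massey $F$-products (here $F_1=F$) if there is a degree $1$ (parity-reversing) linear map $\alpha'\colon F\to C(V)$ with $$\delta\circ\alpha'=\mu\circ(\alpha'\otimes\alpha')\circ\Delta\quad\text{and}\quad \pi\circ\alpha'|_{F_0}=a',$$ where $(\alpha'\otimes\alpha')(x\otimes y)=(-1)^{|x|}\alpha'(x)\otimes\alpha'(y)$. *)

(* Defs.v *)
From HB Require Import structures.
From mathcomp Require Import all_boot all_order perm all_algebra falgebra.
From mathcomp Require Import generic_quotient ring_quotient boolp functions zify.

Set Implicit Arguments.
Unset Strict Implicit.
Unset Printing Implicit Defensive.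
Import GRing.Theory.
Local Open Scope ring_scope.
Local Open Scope quotient_scope.

(* V = V_0 (+) V_1, given by the projections onto V_false and V_true. *)
Record z2grading (k : fieldType) (V : lmodType k) := Z2Grading {
  gpart : bool -> {linear V -> V};
  gpart_sum : forall v, gpart false v + gpart true v = v;
  gpart_gpart : forall p q v,
    gpart p (gpart q v) = if p == q then gpart q v else 0
}.

Definition homog (k : fieldType) (V : lmodType k) (gV : z2grading V)
  (p : bool) (v : V) : Prop := gpart gV p v = v.

(* The homogeneous component of v_1 (x) ... (x) v_n of multidegree e. *)
Definition hparts (k : fieldType) (V : lmodType k) (gV : z2grading V)
  (e : seq bool) (s : seq V) : seq V :=
  [seq gpart gV x.1 x.2 | x <- zip e s].

Definition deg (e : seq bool) : nat := count id e.

(* An element (phi_k)_(k >= 1) of the product of the Hom(V^(k), V) is encoded  *)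
(* as one function f : seq V -> V, phi_k being the restriction of f to the     *)
(* sequences of size k, and f [::] = 0.                                        *)
Section Cochains.
Variables (k : fieldType) (V : lmodType k) (gV : z2grading V).
Implicit Types (f g : seq V -> V) (e : seq bool) (s : seq V).

Definition multilinear_seq f : Prop :=
  forall s1 s2 (c : k) (x y : V),
    f (s1 ++ (c *: x + y) :: s2) = c *: f (s1 ++ x :: s2) + f (s1 ++ y :: s2).

(* Since the characteristic is not 2, this is factorization through the graded *)
(* exterior power.                                                             *)
Definition graded_antisym f : Prop :=
  forall s1 s2 (p q : bool) (x y : V), homog gV p x -> homog gV q y ->
    f (s1 ++ x :: y :: s2) = - ((-1) ^+ (p * q)) *: f (s1 ++ y :: x :: s2).

(* Parity p of C(V): the component of arity n has Z_2-degree p + (n - 1).      *)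
Definition has_parity (p : bool) f : Prop :=
  forall e s, size e = size s ->
    homog gV (p (+) odd (size s).-1 (+) odd (deg e)) (f (hparts gV e s)).

(* The component of Z_2-degree p (without the shift by k - 1). *)
Definition hcomp_at (n : nat) (p : bool) f s : V :=
  \sum_(e : n.-tuple bool) gpart gV (p (+) odd (deg e)) (f (hparts gV e s)).

Definition hcomp (p : bool) f s : V := hcomp_at (size s) p f s.

End Cochains.

Inductive inf_type := Ainf | Linf.

Definition shuffle (n l : nat) (sigma : 'S_n) : bool :=
  [forall i : 'I_n, forall j : 'I_n,
    (i < j)%N && ((j < l)%N || (l <= i)%N) ==> (sigma i < sigma j)%N].

(* epsilon(sigma; v_1, ..., v_n) for v_i of degree e_i: each pair of arguments *)
(* put out of order by sigma contributes (-1) ^ (product of their degrees).    *)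
Definition koszul (R : pzRingType) (n : nat) (sigma : 'S_n) (e : seq bool) : R :=
  \prod_(i < n) \prod_(j < n | (i < j)%N && (sigma j < sigma i)%N)
    (-1) ^+ (nth false e (sigma i) * nth false e (sigma j)).

Definition permute (T : Type) (x0 : T) (n : nat) (sigma : 'S_n) (s : seq T)
  : seq T := [seq nth x0 s (sigma i) | i <- enum 'I_n].

Section Bracket.
Variables (k : fieldType) (V : lmodType k) (gV : z2grading V).
Implicit Types (f g : seq V -> V) (e : seq bool) (s : seq V).

(* The first sum of the bracket [f, g] for f of arity a, g of arity b and      *)
(* Z_2-degree q, at arguments s of degrees e; the second sum exchanges roles.  *)
Definition insertA (a b : nat) (q : bool) f g e s : V :=
  \sum_(0 <= j < a)
    (-1) ^+ (q * deg (take j e) + j * b.-1) *: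
      f (take j s ++ g (take b (drop j s)) :: drop (j + b) s).

Definition insertL (b : nat) f g e s : V :=
  \sum_(sigma : 'S_(size s) | shuffle b sigma)
    ((-1) ^+ sigma * koszul k sigma e) *:
      f (g (take b (permute 0 sigma s)) :: drop b (permute 0 sigma s)).

Definition insert (t : inf_type) (a b : nat) (q : bool) f g e s : V :=
  if t is Ainf then insertA a b q f g e s else insertL b f g e s.

Definition hbracket (t : inf_type) (a b : nat) (p q : bool) f g e s : V :=
  insert t a b q f g e s
  - (-1) ^+ (p * q + a.-1 * b.-1) *: insert t b a p g f e s.

(* The modified bracket {f, g}: at arity n it collects the components of arity *)
(* a and b with a + b - 1 = n, a, b >= 1 (here a = i.+1 and b = n - i), each   *)
(* decomposed, like the arguments, into homogeneous parts.                     *)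
Definition bracket (t : inf_type) f g s : V :=
  \sum_(i < size s) \sum_(p : bool) \sum_(q : bool)
    \sum_(e : (size s).-tuple bool)
      (-1) ^+ (i * q) *:
        hbracket t i.+1 (size s - i) p q (hcomp gV p f) (hcomp gV q g)
          e (hparts gV e s).

Definition is_cochain (t : inf_type) f : Prop :=
  [/\ f [::] = 0, multilinear_seq f & t = Linf -> graded_antisym gV f].

Definition cochain_pred (t : inf_type) : {pred (seq V -> V)} :=
  fun f => `[< is_cochain t f >].

Lemma cochain_submod (t : inf_type) : submod_closed (cochain_pred t).
Proof.
split.
  apply/asboolP; split=> // [s1 s2 c x y | _ s1 s2 p q x y _ _].
    by rewrite /= scaler0 addr0.
  by rewrite /= scaler0.
move=> c f g /asboolP [f0 fl fa] /asboolP [g0 gl ga]; apply/asboolP; split.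
- by rewrite !fctE /= f0 g0 scaler0 addr0.
- move=> s1 s2 a x y; rewrite !fctE /= fl gl !scalerDr !scalerA (mulrC c a).
  by rewrite addrACA.
- move=> tL s1 s2 p q x y hx hy; rewrite !fctE /=.
  rewrite (fa tL _ _ _ _ _ _ hx hy) (ga tL _ _ _ _ _ _ hx hy).
  by rewrite !scalerDr !scalerA (mulrC c).
Qed.

HB.instance Definition _ (t : inf_type) :=
  GRing.isSubmodClosed.Build k (seq V -> V) (cochain_pred t) (cochain_submod t).

Record cochains (t : inf_type) := Cochains {
  cochain_fun :> seq V -> V;
  cochain_funP : cochain_fun \in cochain_pred t
}.
HB.instance Definition _ (t : inf_type) := [isSub for @cochain_fun t].
HB.instance Definition _ (t : inf_type) := [Choice of cochains t by <:].
HB.instance Definition _ (t : inf_type) :=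
  [SubChoice_isSubLmodule of cochains t by <:].

End Bracket.

Section KoszulSign.

Lemma inversions_swap (T : Type) (idx : T) (op : Monoid.com_law idx) (n : nat)
    (F : 'I_n -> 'I_n -> T) (sigma : 'S_n) (a b : 'I_n) :
    (forall x y, F x y = F y x) -> b = a.+1 :> nat ->
  let inv (s : 'S_n) := \big[op/idx]_(x : 'I_n * 'I_n |
    (x.1 < x.2)%N && (s x.2 < s x.1)%N) F (s x.1) (s x.2) in
  exists R,
    inv sigma = op (if (sigma b < sigma a)%N then F (sigma a) (sigma b) else idx) R
    /\ inv (tperm a b * sigma)%g
       = op (if (sigma a < sigma b)%N then F (sigma a) (sigma b) else idx) R.
Proof.
move=> Fsym ab inv.
exists (\big[op/idx]_(x : 'I_n * 'I_n |
   ((x.1 < x.2)%N && (sigma x.2 < sigma x.1)%N) && (x != (a, b)))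
   F (sigma x.1) (sigma x.2)); split.
  rewrite /inv; case: ifP => s; last first.
    rewrite Monoid.mul1m; apply: eq_bigl => -[x y] /=.
    case: (altP ((x, y) =P (a, b))) => [[-> ->]|_]; last by rewrite andbT.
    by rewrite s !andbF.
  by rewrite (bigD1 (a, b)) //= s ab ltnSn.
have inj : {on [pred x | xpredT x], bijective
    (fun x : 'I_n * 'I_n => (tperm a b x.1, tperm a b x.2))}.
  exists (fun x : 'I_n * 'I_n => (tperm a b x.1, tperm a b x.2)) => -[x y] _ /=;
  by rewrite !tpermK.
rewrite /inv (reindex _ (onW_bij _ (Bijective (f := fun x : 'I_n * 'I_n =>
  (tperm a b x.1, tperm a b x.2)) (g := fun x : 'I_n * 'I_n =>
  (tperm a b x.1, tperm a b x.2)) _ _))) /=; try by move=> [x y]; rewrite /= !tpermK.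
have lt_swap x y : (x, y) != (a, b) -> (x, y) != (b, a) ->
    (tperm a b x < tperm a b y)%N = (x < y)%N.
  by rewrite !xpair_eqE -!val_eqE /=; do 2 case: tpermP => [->|->|/eqP + /eqP];
    rewrite -?val_eqE /=; lia.
case: ifP => s.
  rewrite (bigD1 (b, a)) /=; last first.
    by rewrite !permM !tpermK tpermR tpermL ab ltnSn s.
  rewrite !permM !tpermK Fsym; congr (op _ _).
  apply: eq_big => [[x y] /=|[x y] _]; last by rewrite /= !permM !tpermK.
  rewrite !permM !tpermK.
  have [[-> ->]|nab] := eqVneq (x, y) (a, b).
    by rewrite tpermL tpermR ab ltnNge leqnSn !andbF.
  have [[-> ->]|nba] := eqVneq (x, y) (b, a).
    by rewrite andbF ab ltnNge leqnSn.
  by rewrite lt_swap // !andbT.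
rewrite Monoid.mul1m.
apply: eq_big => [[x y] /=|[x y] _]; last by rewrite /= !permM !tpermK.
rewrite !permM !tpermK.
have [[-> ->]|nab] := eqVneq (x, y) (a, b).
  by rewrite tpermL tpermR ab ltnNge leqnSn !andbF.
have [[-> ->]|nba] := eqVneq (x, y) (b, a).
  by rewrite s andbF ab ltnNge leqnSn.
by rewrite lt_swap // !andbT.
Qed.

Lemma perm_descent (n : nat) (sigma : 'S_n) : sigma != 1%g ->
  exists a b : 'I_n, b = a.+1 :> nat /\ (sigma b < sigma a)%N.
Proof.
move=> s1; case: (pselect (exists a b : 'I_n, b = a.+1 :> nat /\
  (sigma b < sigma a)%N)) => // nd; case/negP: s1; apply/eqP.
have asc (a b : 'I_n) : b = a.+1 :> nat -> (sigma a < sigma b)%N.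
  move=> ab; case: (ltngtP (sigma a) (sigma b)) => // h.
    by case: nd; exists a, b.
  by move/val_inj/perm_inj: h ab => ->; lia.
have ge (m : nat) : forall i : 'I_n, i = m :> nat -> (i <= sigma i)%N.
  elim: m => [|m IH] i im; first by rewrite im.
  have lt : (m < n)%N by have := ltn_ord i; lia.
  have := IH (Ordinal lt) erefl; have := asc (Ordinal lt) i im => /=; lia.
have le (m : nat) : forall i : 'I_n, (n - i.+1 = m)%N -> (sigma i <= i)%N.
  elim: m => [|m IH] i im; first by have := ltn_ord (sigma i); lia.
  have lt : (i.+1 < n)%N by lia.
  have /= := IH (Ordinal lt) ltac:(move=> /=; lia).
  have := asc i (Ordinal lt) erefl => /=; lia.
apply/permP => i; rewrite perm1; apply/val_inj/eqP.
by rewrite eqn_leq (le _ i erefl) (ge _ i erefl).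
Qed.

Lemma size_permute (T : Type) (x0 : T) n (sigma : 'S_n) (s : seq T) :
  size (permute x0 sigma s) = n.
Proof. by rewrite size_map -cardE card_ord. Qed.

Lemma nth_permute (T : Type) (x0 : T) n (sigma : 'S_n) (s : seq T) (i : 'I_n) :
  nth x0 (permute x0 sigma s) i = nth x0 s (sigma i).
Proof. by rewrite (nth_map i) ?size_enum_ord // nth_ord_enum. Qed.

Lemma permute_swap (T : Type) (x0 : T) n (sigma : 'S_n) (s : seq T)
    (a b : 'I_n) : b = a.+1 :> nat ->
  exists s1 s2,
    permute x0 sigma s = s1 ++ nth x0 s (sigma a) :: nth x0 s (sigma b) :: s2
    /\ permute x0 (tperm a b * sigma)%g s
       = s1 ++ nth x0 s (sigma b) :: nth x0 s (sigma a) :: s2.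
Proof.
move=> ab; set P := permute x0 sigma s; set Q := permute x0 _ s.
have bn := ltn_ord b.
have dec (L : seq T) : size L = n ->
    L = take a L ++ nth x0 L a :: nth x0 L b :: drop b.+1 L.
  move=> sL; rewrite -{1}(cat_take_drop a L) (drop_nth x0) ?sL 1?ltnW -?ab //.
  by rewrite (drop_nth x0) ?sL.
have PQ i : i != a :> nat -> i != b :> nat -> nth x0 Q i = nth x0 P i.
  move=> ia ib; case: (ltnP i n) => ni; last first.
    by rewrite !nth_default ?size_permute.
  rewrite -[i]/(nat_of_ord (Ordinal ni)) !nth_permute permM tpermD //;
  by rewrite -val_eqE eq_sym.
exists (take a P), (drop b.+1 P); split.
  by rewrite -!nth_permute -dec ?size_permute.
rewrite [LHS]dec ?size_permute //; congr (_ ++ _).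
  apply: (@eq_from_nth _ x0) => [|i]; first by rewrite !size_take !size_permute.
  rewrite size_take size_permute => h.
  have ia : (i < a)%N by move: h; case: ifP; lia.
  by rewrite !nth_take // PQ //; lia.
rewrite /Q !nth_permute !permM tpermL tpermR; congr [:: _, _ & _].
apply: (@eq_from_nth _ x0) => [|i _]; first by rewrite !size_drop !size_permute.
by rewrite !nth_drop PQ //; lia.
Qed.

Lemma koszulE (R : comPzRingType) n (sigma : 'S_n) e : koszul R sigma e =
  \prod_(x : 'I_n * 'I_n | (x.1 < x.2)%N && (sigma x.2 < sigma x.1)%N)
    (-1) ^+ (nth false e (sigma x.1) * nth false e (sigma x.2)).
Proof. by rewrite /koszul pair_big_dep. Qed.

(* The sign in v_1 /\ ... /\ v_n                                               *)
(*   = (-1)^sigma epsilon(sigma) v_sigma(1) /\ ... /\ v_sigma(n).              *)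
Lemma graded_antisym_permute (k : fieldType) (V : lmodType k)
    (gV : z2grading V) (f : seq V -> V) (n : nat) (sigma : 'S_n) e s :
    graded_antisym gV f -> size e = n -> size s = n ->
  f (hparts gV e s) =
    ((-1) ^+ sigma * koszul k sigma e) *: f (permute 0 sigma (hparts gV e s)).
Proof.
move=> fa se ss; set v := hparts gV e s.
have sv : size v = n by rewrite size_map size_zip se ss minnn.
have hv (i : nat) : (i < n)%N -> homog gV (nth false e i) (nth 0 v i).
  move=> ilt; rewrite /homog /v /hparts (nth_map (false, 0)) ?size_zip ?se ?ss ?minnn //.
  by rewrite nth_zip ?se ?ss // gpart_gpart eqxx.
pose ninv (s : 'S_n) := (\sum_(x : 'I_n * 'I_n |
  (x.1 < x.2) && (s x.2 < s x.1)) 1)%N.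
move: {2}(ninv sigma) (leqnn (ninv sigma)) => N.
elim: N sigma => [|N IH] sigma hN; have [->|/perm_descent[a [b [ab lt]]]] := eqVneq sigma 1%g.
- rewrite odd_perm1 koszulE big_pred0 ?mulr1 ?scale1r.
    congr f; apply: (@eq_from_nth _ 0) => [|i]; first by rewrite size_permute.
    by rewrite sv => ilt; rewrite -[i]/(nat_of_ord (Ordinal ilt)) nth_permute perm1.
  by move=> x; rewrite !perm1; lia.
- have [M [E _]] := @inversions_swap _ 0%N addn n (fun _ _ => 1%N) sigma a b (fun _ _ => erefl) ab.
  by move: hN; rewrite /ninv E lt.
- rewrite odd_perm1 koszulE big_pred0 ?mulr1 ?scale1r.
    congr f; apply: (@eq_from_nth _ 0) => [|i]; first by rewrite size_permute.
    by rewrite sv => ilt; rewrite -[i]/(nat_of_ord (Ordinal ilt)) nth_permute perm1.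
  by move=> x; rewrite !perm1; lia.
have [M [E1 E2]] := @inversions_swap _ 0%N addn n (fun _ _ => 1%N) sigma a b (fun _ _ => erefl) ab.
have nlt : (sigma a < sigma b)%N = false by lia.
have {E1 E2}/IH -> : (ninv (tperm a b * sigma)%g <= N)%N.
  by move: hN; rewrite /ninv E1 E2 lt nlt /=; lia.
have nab : a != b by apply/eqP => ab2; move: ab; rewrite ab2; lia.
pose F (x y : 'I_n) : k := (-1) ^+ (nth false e x * nth false e y).
have Fsym x y : F x y = F y x by rewrite /F mulnC.
have [K [E1 E2]] := @inversions_swap _ 1 *%R n F sigma a b Fsym ab.
move: E1 E2; rewrite lt nlt /= -!koszulE => -> ->.
rewrite mul1r odd_mul_tperm nab /=.
have [s1 [s2 [-> ->]]] := permute_swap 0 sigma v ab.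
rewrite (fa _ _ _ _ _ _ (hv _ (ltn_ord (sigma b))) (hv _ (ltn_ord (sigma a)))).
rewrite scalerA; congr (_ *: _); rewrite -/(F (sigma b) (sigma a)) Fsym.
by rewrite signrN !mulNr mulrN opprK -mulrA (mulrC K).
Qed.

End KoszulSign.

Section Cohomology.
Variables (k : fieldType) (V : lmodType k) (gV : z2grading V) (t : inf_type).
Implicit Types (f g : seq V -> V).

Lemma hcomp_linear (p : bool) c f g :
  hcomp gV p (c *: f + g) = c *: hcomp gV p f + hcomp gV p g.
Proof.
apply/funext => s; rewrite /hcomp /hcomp_at !fctE /= scaler_sumr -big_split /=.
by apply: eq_bigr => e _; rewrite linearP.
Qed.

Lemma hparts_cat e1 e2 (s1 s2 : seq V) : size e1 = size s1 ->
  hparts gV (e1 ++ e2) (s1 ++ s2) = hparts gV e1 s1 ++ hparts gV e2 s2.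
Proof. by move=> h; rewrite /hparts zip_cat // map_cat. Qed.

Lemma hcomp_multilinear (p : bool) f :
  multilinear_seq f -> multilinear_seq (hcomp gV p f).
Proof.
move=> fl s1 s2 c x y; rewrite /hcomp !size_cat /= /hcomp_at.
rewrite scaler_sumr -big_split /=; apply: eq_bigr => e _.
have se : size e = (size s1 + (size s2).+1)%N by rewrite size_tuple.
move: se; case: e => e /= _ se.
rewrite -(cat_take_drop (size s1) e).
have s1e : size (take (size s1) e) = size s1.
  by rewrite size_take_min se; apply/minn_idPl; rewrite leq_addr.
rewrite !hparts_cat //.
have : size (drop (size s1) e) = (size s2).+1 by rewrite size_drop se addKn.
case: (drop (size s1) e) => //= q e2 [se2].
by rewrite /hparts /= linearP fl linearP.
Qed.

Lemma insert_linearl a b q c f f' g e s :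
  insert t a b q (c *: f + f') g e s
    = c *: insert t a b q f g e s + insert t a b q f' g e s.
Proof.
case: t => /=; rewrite scaler_sumr -big_split; apply: eq_bigr => i _;
  by rewrite !fctE /= scalerDr !scalerA (mulrC c).
Qed.

Lemma insert_linearr a b q c f g g' e s : multilinear_seq f ->
  insert t a b q f (c *: g + g') e s
    = c *: insert t a b q f g e s + insert t a b q f g' e s.
Proof.
move=> fl; case: t => /=; rewrite scaler_sumr -big_split;
    apply: eq_bigr => i _; rewrite !fctE /=.
  by rewrite fl scalerDr !scalerA (mulrC c).
by rewrite -[LHS]/(_ *: f ([::] ++ _)) fl scalerDr !scalerA (mulrC c).
Qed.

Lemma bracket_linearr c f g g' : multilinear_seq f ->
  bracket gV t f (c *: g + g') = c *: bracket gV t f g + bracket gV t f g'.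
Proof.
move=> fl; apply/funext => s; rewrite /bracket !fctE /=.
do 4 ![rewrite scaler_sumr -big_split /=; apply: eq_bigr => ? _].
rewrite /hbracket hcomp_linear insert_linearl insert_linearr; last first.
  exact: hcomp_multilinear.
rewrite scalerA [c * _]mulrC -scalerA -scalerDr; congr (_ *: _).
rewrite scalerBr scalerDr !scalerA [c * _]mulrC.
by rewrite opprD addrACA.
Qed.

Variable d : cochains gV t.

Let d_multilinear : multilinear_seq d.
Proof. by have /asboolP [] := cochain_funP d. Qed.

Definition delta (phi : cochains gV t) : seq V -> V := bracket gV t d phi.

Lemma delta_linear : linear delta.
Proof. by move=> c f g; rewrite /delta -bracket_linearr. Qed.

HB.instance Definition _ :=
  GRing.isLinear.Build k (cochains gV t) (seq V -> V) *:%R delta delta_linear.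

Definition cocycle_pred : {pred cochains gV t} := fun phi => delta phi == 0.

Lemma cocycle_submod : submod_closed cocycle_pred.
Proof.
split=> [|c f g]; first by rewrite unfold_in linear0.
move=> /eqP f0 /eqP g0; apply/eqP.
by rewrite delta_linear f0 g0 scaler0 addr0.
Qed.

HB.instance Definition _ :=
  GRing.isSubmodClosed.Build k (cochains gV t) cocycle_pred cocycle_submod.

Record cocycles := Cocycles {
  cocycle_val :> cochains gV t;
  cocycle_valP : cocycle_val \in cocycle_pred
}.
HB.instance Definition _ := [isSub for cocycle_val].
HB.instance Definition _ := [Choice of cocycles by <:].
HB.instance Definition _ := [SubChoice_isSubLmodule of cocycles by <:].

Definition coboundary_pred : {pred cocycles} := fun z =>
  `[< exists psi : cochains gV t, delta psi = z :> (seq V -> V) >].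

Lemma coboundary_submod : submod_closed coboundary_pred.
Proof.
split; first by apply/asboolP; exists 0; rewrite linear0.
move=> c z1 z2 /asboolP [f hf] /asboolP [g hg]; apply/asboolP.
by exists (c *: f + g); rewrite delta_linear hf hg.
Qed.

HB.instance Definition _ :=
  GRing.isSubmodClosed.Build k cocycles coboundary_pred coboundary_submod.

(* H(V) = ker delta / im delta *)
Definition cohomology := Quotient.quot coboundary_pred.
HB.instance Definition _ := GRing.Zmodule.on cohomology.

Definition cohomology_pi (z : cocycles) : cohomology := \pi_cohomology z.

Lemma cohomologyW (P : cohomology -> Prop) :
  (forall z, P (cohomology_pi z)) -> forall x, P x.
Proof.
by move=> h x; rewrite -[x](@reprK _ (Quotient.quot coboundary_pred)).
Qed.

Lemma cohomology_piP z1 z2 :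
  cohomology_pi z1 = cohomology_pi z2 <->
  exists psi : cochains gV t, delta psi = z1 - z2 :> (seq V -> V).
Proof.
split=> [/eqP|h]; last apply/eqP.
  by rewrite /cohomology_pi -Quotient.idealrBE => /asboolP.
by rewrite /cohomology_pi -Quotient.idealrBE; apply/asboolP.
Qed.

Definition cohomology_scale (c : k) (x : cohomology) : cohomology :=
  cohomology_pi (c *: repr x).

Lemma cohomology_piZ c z :
  cohomology_scale c (cohomology_pi z) = cohomology_pi (c *: z).
Proof.
apply/eqP; rewrite /cohomology_scale /cohomology_pi -Quotient.idealrBE -scalerBr.
apply: rpredZ; rewrite Quotient.idealrBE; apply/eqP; exact: reprK.
Qed.

Lemma cohomology_piD z1 z2 :
  cohomology_pi (z1 + z2) = cohomology_pi z1 + cohomology_pi z2.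
Proof. by rewrite /cohomology_pi !piE. Qed.

Lemma cohomology_scaleA a b x :
  cohomology_scale a (cohomology_scale b x) = cohomology_scale (a * b) x.
Proof. by elim/cohomologyW: x => z; rewrite !cohomology_piZ scalerA. Qed.
Lemma cohomology_scale1 : left_id 1 cohomology_scale.
Proof. by elim/cohomologyW => z; rewrite cohomology_piZ scale1r. Qed.
Lemma cohomology_scaleDr : right_distributive cohomology_scale +%R.
Proof.
move=> c; elim/cohomologyW => x; elim/cohomologyW => y.
by rewrite -cohomology_piD !cohomology_piZ scalerDr cohomology_piD.
Qed.
Lemma cohomology_scaleDl x :
  {morph cohomology_scale^~ x : a b / a + b}.
Proof.
by elim/cohomologyW: x => z a b; rewrite !cohomology_piZ scalerDl cohomology_piD.
Qed.

HB.instance Definition _ := GRing.Zmodule_isLmodule.Build k cohomology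
  cohomology_scaleA cohomology_scale1 cohomology_scaleDr cohomology_scaleDl.

Lemma cohomology_pi_linear : linear cohomology_pi.
Proof. by move=> c x y; rewrite cohomology_piD -cohomology_piZ. Qed.
HB.instance Definition _ :=
  GRing.isLinear.Build k cocycles cohomology *:%R cohomology_pi
    cohomology_pi_linear.

End Cohomology.

(* V (x) W for W finite-dimensional: the element sum_j x_j (x) b_j, where b is *)
(* the basis vbasis fullv of W, is encoded by its coordinates x_j in V.        *)
(* tens_liftE and tens_lift_unique are the universal property.                 *)
Definition tens (k : fieldType) (V : lmodType k) (W : vectType k) : Type :=
  {ffun 'I_(\dim (fullv : {vspace W})) -> V}.
HB.instance Definition _ (k : fieldType) (V : lmodType k) (W : vectType k) :=
  GRing.Lmodule.copy (tens V W) {ffun 'I_(\dim (fullv : {vspace W})) -> V}.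

Section Tensor.
Variables (k : fieldType) (V : lmodType k) (W : vectType k).

Definition ten (v : V) (w : W) : tens V W :=
  [ffun j => coord (vbasis fullv) j w *: v].

Definition tens_lift (U : lmodType k) (B : V -> W -> U) (x : tens V W) : U :=
  \sum_j B (x j) (vbasis fullv)`_j.

Lemma ten_linearl w : linear (ten^~ w).
Proof.
by move=> c x y; apply/ffunP => j; rewrite !ffunE scalerDr !scalerA mulrC.
Qed.

Lemma ten_linearr v : linear (ten v).
Proof.
by move=> c x y; apply/ffunP => j; rewrite !ffunE linearP scalerDl scalerA.
Qed.

Lemma tens_sum (x : tens V W) : x = \sum_j ten (x j) (vbasis fullv)`_j.
Proof.
apply/ffunP => i; rewrite sum_ffunE (bigD1 i) //= big1 ?addr0.
  by rewrite ffunE coord_free ?eqxx ?scale1r // (basis_free (vbasisP _)).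
move=> j ji; rewrite ffunE coord_free ?(basis_free (vbasisP _)) //.
by rewrite (negPf ji) scale0r.
Qed.

Lemma tens_liftE (U : lmodType k) (B : V -> W -> U) :
  (forall w, linear (B^~ w)) -> (forall v, linear (B v)) ->
  forall v w, tens_lift B (ten v w) = B v w.
Proof.
move=> Bl Br v w.
pose Bv : {linear W -> U} := HB.pack (B v) (GRing.isLinear.Build k W U *:%R (B v) (Br v)).
rewrite -[RHS]/(Bv w) {2}(coord_vbasis (memvf w)) linear_sum.
apply: eq_bigr => j _; rewrite ffunE.
pose Bw : {linear V -> U} := HB.pack (B^~ (vbasis fullv)`_j)
  (GRing.isLinear.Build k V U *:%R _ (Bl (vbasis fullv)`_j)).
by rewrite linearZ -[LHS]/(Bw _) linearZ.
Qed.

Lemma tens_lift_unique (U : lmodType k) (L1 L2 : {linear tens V W -> U}) :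
  (forall v w, L1 (ten v w) = L2 (ten v w)) -> L1 =1 L2.
Proof.
move=> L12 x; rewrite (tens_sum x) !linear_sum.
by apply: eq_bigr => j _; rewrite L12.
Qed.

Lemma tens_lift_linear (U : lmodType k) (B : V -> W -> U) :
  (forall w, linear (B^~ w)) -> linear (tens_lift B).
Proof.
move=> Bl c x y; rewrite /tens_lift scaler_sumr -big_split /=.
by apply: eq_bigr => j _; rewrite !ffunE Bl.
Qed.

Variables (gV : z2grading V) (gW : z2grading W).

(* (V (x) W)_p is the sum of the V_q (x) W_(p+q). *)
Definition tens_part_fun (p : bool) : tens V W -> tens V W :=
  tens_lift (fun v w => \sum_(q : bool) ten (gpart gV q v) (gpart gW (p (+) q) w)).

Lemma tens_part_bil_l p w :
  linear (fun v => \sum_(q : bool) ten (gpart gV q v) (gpart gW (p (+) q) w)).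
Proof.
move=> c x y; rewrite scaler_sumr -big_split; apply: eq_bigr => q _ /=.
by rewrite linearP ten_linearl.
Qed.
Lemma tens_part_bil_r p v :
  linear (fun w => \sum_(q : bool) ten (gpart gV q v) (gpart gW (p (+) q) w)).
Proof.
move=> c x y; rewrite scaler_sumr -big_split; apply: eq_bigr => q _ /=.
by rewrite linearP ten_linearr.
Qed.

Lemma tens_part_ten p v w : tens_part_fun p (ten v w) =
  \sum_(q : bool) ten (gpart gV q v) (gpart gW (p (+) q) w).
Proof.
apply: (tens_liftE (B := fun v w => _)) => [w' | v'].
  exact: tens_part_bil_l.
exact: tens_part_bil_r.
Qed.

Lemma tens_part_linear p : linear (tens_part_fun p).
Proof. by apply: tens_lift_linear => w; apply: tens_part_bil_l. Qed.
HB.instance Definition _ p := GRing.isLinear.Build k (tens V W) (tens V W) *:%R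
  (tens_part_fun p) (tens_part_linear p).
Definition tens_part p : {linear tens V W -> tens V W} := tens_part_fun p.

Lemma ten0l w : ten 0 w = 0.
Proof. by apply/ffunP => j; rewrite !ffunE scaler0. Qed.
Lemma ten0r v : ten v 0 = 0.
Proof. by apply/ffunP => j; rewrite !ffunE linear0 scale0r. Qed.
Lemma tenDl v1 v2 w : ten (v1 + v2) w = ten v1 w + ten v2 w.
Proof. by rewrite -[v1]scale1r ten_linearl !scale1r. Qed.
Lemma tenDr v w1 w2 : ten v (w1 + w2) = ten v w1 + ten v w2.
Proof. by rewrite -[w1]scale1r ten_linearr !scale1r. Qed.

Lemma tens_part_sum x : tens_part false x + tens_part true x = x.
Proof.
rewrite {3}[x]tens_sum {1 2}[x]tens_sum !linear_sum -big_split /=.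
apply: eq_bigr => j _; rewrite !tens_part_ten !big_bool /=.
set v := x j; set w := _`_j.
rewrite -{5}[v](gpart_sum gV) -{5}[w](gpart_sum gW) !tenDl !tenDr.
rewrite addrC addrACA [in RHS]addrC; congr (_ + _); rewrite addrC //.
Qed.

Lemma tens_part_part p q x :
  tens_part p (tens_part q x) = if p == q then tens_part q x else 0.
Proof.
pose L (b : bool) : {linear tens V W -> tens V W} := if b then tens_part q else \0.
suff: tens_part p \o tens_part q =1 L (p == q).
  by move=> /(_ x) /= E; rewrite [LHS]E /L; case: eqP.
apply: tens_lift_unique => v w.
transitivity (tens_part p (\sum_(r : bool) ten (gpart gV r v) (gpart gW (q (+) r) w))).
  by rewrite -tens_part_ten.
rewrite linear_sum.
transitivity (if p == q then tens_part_fun q (ten v w) else 0); last first.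
  by rewrite /L; case: eqP.
rewrite tens_part_ten.
have inner r : tens_part_fun p (ten (gpart gV r v) (gpart gW (q (+) r) w))
    = if p == q then ten (gpart gV r v) (gpart gW (q (+) r) w) else 0.
  rewrite tens_part_ten (bigD1 r) //= big1 ?addr0; last first.
    by move=> i ir; rewrite gpart_gpart (negPf ir) ten0l.
  rewrite !gpart_gpart eqxx (inj_eq (@addIb r)).
  by case: eqP => _ //; rewrite ten0r.
apply: etrans; first by apply: eq_bigr => r _; exact: inner.
by case: eqP => // _; rewrite big1.
Qed.

Definition tens_grading : z2grading (tens V W) :=
  Z2Grading tens_part_sum tens_part_part.

End Tensor.

Definition inf_structure (k : fieldType) (V : lmodType k) (gV : z2grading V)
  (t : inf_type) (d : cochains gV t) : Prop :=
  has_parity gV true d /\ bracket gV t d d = 0.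

Definition graded_commutative (k : fieldType) (S : falgType k)
  (gS : z2grading S) : Prop :=
  [/\ homog gS false 1,
      forall p q x y, homog gS p x -> homog gS q y ->
        homog gS (p (+) q) (x * y)
    & forall p q x y, homog gS p x -> homog gS q y ->
        x * y = (-1) ^+ (p * q) * (y * x)].

Section Dual.
Variables (k : fieldType) (S : falgType k) (gS : z2grading S).
Implicit Types (m I : {vspace S}).

Definition is_ideal I : Prop :=
  forall s x, x \in I -> s * x \in I /\ x * s \in I.

Definition maximal_ideal m : Prop :=
  [/\ is_ideal m, m <> fullv
    & forall I, is_ideal I -> (m <= I)%VS -> I = m \/ I = fullv].

Definition dual m : vectType k := 'Hom(subvs_of m, k^o).

(* The component of degree p of a linear form on m (m being graded): its       *)
(* restriction to m_p extended by 0.                                           *)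
Definition dual_part m (p : bool) (f : dual m) : dual m :=
  (f \o linfun (vsproj m \o gpart gS p \o vsval))%VF.

Lemma dual_partE m (p : bool) (f : dual m) (x : subvs_of m) :
  dual_part p f x = f (vsproj m (gpart gS p (vsval x))).
Proof. by rewrite comp_lfunE lfunE. Qed.

(* F_0 = (m / m^2)^*, as the kernel of the restriction map m^* -> (m^2)^*.      *)
Definition dual0 m : {vspace dual m} :=
  lker (linfun (fun f : dual m =>
    (f \o linfun (vsproj m \o vsval) : 'Hom(subvs_of (m * m)%VS, k^o))%VF)).

Lemma mem_dual0 m (f : dual m) : f \in dual0 m <->
  forall x y, x \in m -> y \in m -> f (vsproj m (x * y)) = 0.
Proof.
pose r (g : dual m) : 'Hom(subvs_of (m * m)%VS, k^o) :=
  (g \o linfun (vsproj m \o vsval))%VF.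
have rl : linear r.
  by move=> c g h; apply/lfunP => x; rewrite /r !(comp_lfunE, add_lfunE, scale_lfunE).
have rE g (x : subvs_of (m * m)%VS) : r g x = g (vsproj m (vsval x)).
  by rewrite comp_lfunE lfunE.
pose rL : {linear dual m -> _} := HB.pack r (GRing.isLinear.Build k _ _ *:%R r rl).
have -> : (f \in dual0 m) = (r f == 0).
  by rewrite memv_ker (lfunE rL).
split=> [/eqP rf0 x y xm ym|h].
  by rewrite -(vsprojK (memv_mul xm ym)) -rE rf0 zero_lfunE.
apply/eqP/lfunP => x; rewrite rE zero_lfunE.
have := subvsP x; move: (vsval x) => z zm.
have sub : (m * m <= lker (linfun (f \o vsproj m)))%VS.
  by apply/prodvP => u v um vm; rewrite memv_ker lfunE /= h.
by have := subvP sub z zm; rewrite memv_ker lfunE => /eqP.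
Qed.

Definition homog_basis m (N : nat) (b : N.-tuple (subvs_of m))
  (p : 'I_N -> bool) : Prop :=
  basis_of fullv b /\ forall i, homog gS (p i) (vsval (tnth b i)).

Section Comultiplication.
Variables (m : {vspace S}) (N : nat) (b : N.-tuple (subvs_of m))
  (p : 'I_N -> bool).

Definition dual_basis (i : 'I_N) : dual m := linfun (coord b i : _ -> k^o).

Definition struct_const (i j l : 'I_N) : k :=
  coord b l (vsproj m (vsval (tnth b i) * vsval (tnth b j))).

Definition comult_basis (l : 'I_N) : tens (dual m) (dual m) :=
  \sum_i \sum_j
    ((-1) ^+ (p i * p j) * struct_const i j l) *:
      ten (dual_basis i) (dual_basis j).

Definition comult (f : dual m) : tens (dual m) (dual m) :=
  \sum_l (f (tnth b l) : k) *: comult_basis l.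

End Comultiplication.
End Dual.

(* m is automatically graded (odd elements square to 0), so the homogeneous    *)
(* bases used to define the comultiplication exist.                            *)
Lemma homog_basis_exists (k : fieldType) (S : falgType k) (gS : z2grading S)
    (m : {vspace S}) (eps : {lrmorphism S -> k^o}) :
    2%N \notin [pchar k] -> graded_commutative gS ->
    (forall s, (s \in m) = (eps s == 0)) ->
  exists (N : nat) (b : N.-tuple (subvs_of m)) (p : 'I_N -> bool),
    homog_basis gS b p.
Proof.
move=> k2 [_ _ gC] meps.
have k2' : (2%:R : k) != 0 by move: k2; rewrite inE.
have odd_m x : homog gS true x -> x \in m.
  move=> hx; have /eqP := gC _ _ _ _ hx hx.
  rewrite expr1 mulN1r -addr_eq0 -mulr2n -scaler_nat scaler_eq0 (negPf k2') /=.
  move=> /eqP /(congr1 eps); rewrite rmorphM rmorph0 => /eqP.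
  by rewrite mulf_eq0 orbb meps.
have part_odd v : homog gS true (gpart gS true v) by rewrite /homog gpart_gpart.
have part_m p x : x \in m -> gpart gS p x \in m.
  move=> xm; case: p; first exact: odd_m.
  rewrite -(addrK (gpart gS true x) (gpart gS false x)) gpart_sum.
  by rewrite rpredB // odd_m.
pose P p : 'End(subvs_of m) := linfun (vsproj m \o gpart gS p \o vsval).
have PE p x : vsval (P p x) = gpart gS p (vsval x).
  by rewrite lfunE /= vsprojK // part_m // subvsP.
have hP p x : x \in limg (P p) -> homog gS p (vsval x).
  by case/memv_imgP => y _ ->; rewrite /homog !PE gpart_gpart eqxx.
have full : (limg (P false) + limg (P true))%VS = fullv.
  apply/eqP; rewrite eqEsubv subvf; apply/subvP => x _.
  have -> : x = P false x + P true x.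
    by apply: val_inj; rewrite /= !PE gpart_sum.
  by rewrite memv_add // memv_img // memvf.
have dir : directv (limg (P false) + limg (P true)).
  apply/directv_addP/eqP; rewrite -subv0; apply/subvP => x.
  rewrite memv_cap => /andP [/hP h0 /hP h1].
  rewrite memv0; apply/eqP/val_inj => /=.
  by rewrite -[LHS]h0 -h1 gpart_gpart.
pose b0 := vbasis (limg (P false)); pose b1 := vbasis (limg (P true)).
exists _, [tuple of b0 ++ b1], (fun i => ~~ (i < size b0)%N); split.
  have := cat_basis dir (vbasisP _) (vbasisP _).
  by rewrite [X in basis_of X]full.
move=> i; rewrite (tnth_nth 0) /= nth_cat; case: ltnP => h /=.
  by apply/hP/vbasis_mem/mem_nth.
apply/hP/vbasis_mem/mem_nth; rewrite ltn_subLR //.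
by rewrite [X in (_ < X + _)%N]size_tuple [X in (_ < _ + X)%N]size_tuple.
Qed.

Section Deformation.
Variables (k : fieldType) (V : lmodType k) (gV : z2grading V) (t : inf_type).
Variable d : cochains gV t.
Variables (S : falgType k) (gS : z2grading S) (m : {vspace S}).

Definition tens_scale (x : tens V S) (s : S) : tens V S :=
  tens_lift (fun v u => ten v (u * s)) x.

(* Multilinearity over S for the right S-module V (x) S: a scalar s of degree  *)
(* p leaves to the right of the arguments that follow it.                      *)
Definition S_multilinear (tau : seq (tens V S) -> tens V S) : Prop :=
  forall s1 x s2 e (p : bool) (s : S), homog gS p s -> size e = size s2 ->
    tau (s1 ++ tens_scale x s :: hparts (tens_grading gV gS) e s2) =
    (-1) ^+ (p * deg e) *:
      tens_scale (tau (s1 ++ x :: hparts (tens_grading gV gS) e s2)) s.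

Definition deformation (eps : {lrmorphism S -> k^o})
  (tau : cochains (tens_grading gV gS) t) : Prop :=
  [/\ inf_structure tau, S_multilinear tau
    & forall s : seq (V * S),
        tens_lift (fun v x => (eps x : k) *: v) (tau [seq ten u.1 u.2 | u <- s])
        = (eps (\prod_(u <- s) u.2) : k) *: d [seq u.1 | u <- s]].

(* (1 (x) f)(v (x) x) = (-1)^(f v) v f(x), for x in m. *)
Definition pairing (f : dual m) (v : V) (x : S) : V :=
  \sum_(p : bool) \sum_(q : bool)
    (-1) ^+ (q * p) *: ((dual_part gS q f (vsproj m x) : k) *: gpart gV p v).

(* The argument of tens_lift lies in V (x) m, so the complement of m implicit  *)
(* in vsproj is irrelevant.                                                    *)
Definition alpha (tau : seq (tens V S) -> tens V S) (f : dual m)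
  (s : seq V) : V :=
  tens_lift (pairing f) (tau [seq ten v 1 | v <- s] - ten (d s) 1).

Definition differential_of (tau : seq (tens V S) -> tens V S)
  (a : subvs_of (dual0 m) -> cohomology d) : Prop :=
  forall f : subvs_of (dual0 m), exists z : cocycles d,
    alpha tau (vsval f) = z :> (seq V -> V) /\ cohomology_pi z = a f.

(* mu o (alpha' (x) alpha') : F (x) F -> C(V) *)
Definition mu_tens (alpha' : dual m -> cochains gV t) :
  tens (dual m) (dual m) -> (seq V -> V) :=
  tens_lift (fun x y => \sum_(p : bool)
    (-1) ^+ p *: bracket gV t (alpha' (dual_part gS p x)) (alpha' y)).

Definition massey_trivial (N : nat) (b : N.-tuple (subvs_of m))
  (p : 'I_N -> bool) (a' : subvs_of (dual0 m) -> cohomology d) : Prop :=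
  exists alpha' : {linear dual m -> cochains gV t},
    [/\ forall q f, dual_part gS q f = f -> has_parity gV (~~ q) (alpha' f),
        forall f, delta d (alpha' f) = mu_tens alpha' (comult b p f)
      & forall f : subvs_of (dual0 m), exists z : cocycles d,
          alpha' (vsval f) = z /\ cohomology_pi z = a' f].

End Deformation.

(* Main.v *)
(* Write tau(v (x) 1) = d(v) (x) 1 + sum_i beta_i(v) (x) m_i in a homogeneous  *)
(* basis (m_i) of the maximal ideal; then alpha(m^i) is beta_i up to a sign    *)
(* that depends on the degree of the output only. Being S-multilinear, tau is  *)
(* determined by the alpha(m^i), which can be arbitrary cochains of the right  *)
(* parity, and {tau, tau} is S-multilinear as well, so that the equation       *)
(* {tau, tau} = 0 need only be tested on arguments v (x) 1. For f of any       *)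
(* parity, {f, g} is the signed commutator of a composition f o g, whence      *)
(* {tau, tau} = 2 tau o tau, and the coefficient of m_j in tau o tau is, up to *)
(* sign,                                                                       *)
(*   delta(alpha_j) + sum_(l, i) +- c_li^j alpha_l o alpha_i.                  *)
(* By graded commutativity the sum is half of mu (alpha (x) alpha) Delta, so   *)
(* the equation is the Massey equation for alpha' = - alpha / 2.               *)
From HB Require Import structures.
Require Import Defs.
From mathcomp Require Import all_boot all_order perm all_algebra falgebra.
From mathcomp Require Import boolp functions zify ring.

Set Implicit Arguments.
Unset Strict Implicit.
Unset Printing Implicit Defensive.
Import GRing.Theory.
Local Open Scope ring_scope.

(** * Signs and homogeneous sequences *)

(** A deformation is an odd solution of {tau, tau} = 0 that reduces to [d] modulo the maximal ideal
    m. Expanded in a homogeneous basis of S made of 1 and a basis of m, this single equation becomes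
    a family of equations on V: the coefficient of 1 is {d, d} = 0, and the coefficient of each m_j
    is a Maurer-Cartan equation, linear part delta and quadratic part given by the structure
    constants of m. The Massey condition is the same family after rescaling by -1/2.

    The bracket is first written as a graded commutator of an insertion product ([bracket_circ]), so
    that {tau, tau} is twice [circ] of [tau] with itself. That product is S-multilinear
    ([circ_scale]), hence vanishes as soon as it does on arguments v (x) 1 ([circ_vanish]); there
    [circ_ten1] expands it into products of the components of [tau]. [bracket_mc] turns the equation
    into its coordinates, which [mc_None] and [mc_massey] identify.

    Conversely, a family of cochains of the right parities is assembled into [tau] by the
    S-multilinear extension [ext], whose reduction modulo m is computed by [contract_ext]. In both
    directions [alpha_basis] recognizes the components of [tau] as the values of [alpha], which
    matches the classes in cohomology. *)

Lemma eq_sign (R : pzRingType) (m n : nat) :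
  odd m = odd n -> (-1) ^+ m = (-1) ^+ n :> R.
Proof. by move=> mn; rewrite -(signr_odd _ m) mn signr_odd. Qed.

(** Signs agree when their exponents agree modulo 2, which is a finite check over booleans and over
    the parities of the remaining naturals. Hypotheses are cleared first so that these can be
    destructed freely. *)
Ltac parity_cases :=
  repeat match goal with H : _ |- _ => clear H end;
  repeat match goal with
  | |- context [odd ?x] => case: (odd x)
  | b : ?A |- _ => unify A bool; case: b
  end; done.

Ltac parity :=
  apply: eq_sign; rewrite ?(oddD, oddM, oddS, oddb, mulnb) /=; parity_cases.

Section HomogeneousSequences.
Variables (k : fieldType) (V : lmodType k) (gV : z2grading V).
Implicit Types (f g : seq V -> V) (e : seq bool) (s : seq V) (p q r : bool).

Lemma gpart_homog p r v : homog gV r v -> gpart gV p v = if p == r then v else 0.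
Proof. by move=> hv; rewrite -{1}hv gpart_gpart; case: ifP => // _; rewrite hv. Qed.

Lemma homog_gpart p v : homog gV p (gpart gV p v).
Proof. by rewrite /homog gpart_gpart eqxx. Qed.

Lemma homog0 p : homog gV p 0.
Proof. exact: linear0. Qed.

Lemma homogD p u v : homog gV p u -> homog gV p v -> homog gV p (u + v).
Proof. by rewrite /homog linearD => -> ->. Qed.

Lemma homogZ p (c : k) v : homog gV p v -> homog gV p (c *: v).
Proof. by rewrite /homog linearZ => /= ->. Qed.

Lemma homog_sum p (I : Type) (r : seq I) (P : pred I) (F : I -> V) :
  (forall i, P i -> homog gV p (F i)) -> homog gV p (\sum_(i <- r | P i) F i).
Proof. by move=> h; elim/big_ind: _ => [|u v|] //; [exact: homog0 | exact: homogD]. Qed.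

(* (1 (x) f)(v (x) x) = f(x) twist q v for f and x of degree q *)
Definition twist (q : bool) (v : V) : V :=
  gpart gV false v + (-1) ^+ q *: gpart gV true v.

Lemma twist_linear q : linear (twist q).
Proof.
move=> c x y; rewrite /twist !linearP /= !scalerDr !scalerA [c * _]mulrC.
by rewrite addrACA.
Qed.
HB.instance Definition _ q :=
  GRing.isLinear.Build k V V *:%R (twist q) (twist_linear q).

Lemma twistD q u v : twist q (u + v) = twist q u + twist q v.
Proof. exact: linearD. Qed.

Lemma twist_homog q r v : homog gV r v -> twist q v = (-1) ^+ (q * r) *: v.
Proof.
move=> hv; rewrite /twist !(gpart_homog _ hv).
by case: r hv => /= _; rewrite ?muln1 ?muln0 ?scaler0 ?add0r ?addr0 ?expr0 ?scale1r.
Qed.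

Lemma twist0 v : twist false v = v.
Proof. by rewrite /twist scale1r gpart_sum. Qed.

Lemma gpart_twist p q v : gpart gV p (twist q v) = (-1) ^+ (q * p) *: gpart gV p v.
Proof.
rewrite /twist linearD linearZ /= !gpart_gpart.
by case: p; rewrite /= ?muln1 ?muln0 ?scaler0 ?add0r ?addr0 ?expr0 ?scale1r.
Qed.

Lemma homog_twist p q v : homog gV p v -> homog gV p (twist q v).
Proof. by rewrite /homog gpart_twist => hv; rewrite (twist_homog _ hv) hv. Qed.

Lemma twistK q : involutive (twist q).
Proof.
move=> v; rewrite {1}/twist !gpart_twist muln0 muln1 scale1r scalerA.
by rewrite -expr2 sqrr_sign scale1r gpart_sum.
Qed.

(** Homogeneity of every argument, with degrees listed by [e], is phrased as a fixed point of
    [hparts] so that [has_parity] and [bracket] apply by rewriting. *)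
Definition hseq e s := size e = size s /\ hparts gV e s = s.

Lemma hseq_nil : hseq [::] [::].
Proof. by []. Qed.

Lemma hseq_cons p e v s : hseq (p :: e) (v :: s) <-> homog gV p v /\ hseq e s.
Proof.
rewrite /hseq /hparts /homog /=; split=> [[[h] [-> ->]]|[-> [-> ->]]] //.
Qed.

Lemma hseq_cat e1 s1 e2 s2 : size e1 = size s1 ->
  hseq (e1 ++ e2) (s1 ++ s2) <-> hseq e1 s1 /\ hseq e2 s2.
Proof.
elim: e1 s1 => [|p e1 IH] [|v s1] //= => [_|[h]].
  by split=> [|[]].
by rewrite !hseq_cons IH //; tauto.
Qed.

Lemma hseq_size e s : hseq e s -> size e = size s. Proof. by case. Qed.

Lemma size_hparts e s : size e = size s -> size (hparts gV e s) = size s.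
Proof. by move=> h; rewrite size_map size_zip h minnn. Qed.

Lemma hseq_hparts e s : size e = size s -> hseq e (hparts gV e s).
Proof.
elim: e s => [|p e IH] [|v s] //= [h].
by apply/hseq_cons; split; [exact: homog_gpart | exact: IH].
Qed.

Lemma hseqP e s : hseq e s <->
  size e = size s /\ forall i, (i < size s)%N -> homog gV (nth false e i) (nth 0 s i).
Proof.
elim: e s => [|p e IH] [|v s]; first by split.
- by split=> -[].
- by split=> -[].
rewrite hseq_cons IH /=; split=> [[hv [-> h]]|[[->] h]].
  by split=> // -[|i] //=; exact: h.
by split; [exact: (h 0%N) | split=> // i; exact: (h i.+1)].
Qed.

Lemma has_parity_homog (f : seq V -> V) p e s : has_parity gV p f -> hseq e s ->
  homog gV (p (+) odd (size s).-1 (+) odd (deg e)) (f s).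
Proof. by move=> fp [es hs]; have := fp _ _ es; rewrite hs. Qed.

(** Multilinearity with values in another module, as required for maps from arguments in V to V (x)
    S. *)
Definition multilin (U : lmodType k) (f : seq V -> U) : Prop :=
  forall s1 s2 (c : k) x y,
    f (s1 ++ (c *: x + y) :: s2) = c *: f (s1 ++ x :: s2) + f (s1 ++ y :: s2).

Lemma multilinear_seq0 (U : lmodType k) (f : seq V -> U) s1 s2 :
  multilin f -> f (s1 ++ 0 :: s2) = 0.
Proof.
move=> fl; have := fl s1 s2 1 0 0; rewrite scale1r addr0 => /esym/eqP.
by rewrite -subr_eq0 scale1r addrK => /eqP.
Qed.

(** Multilinear expansion of each argument as the sum of its even and odd parts. *)
Lemma sum_hparts (U : lmodType k) (f : seq V -> U) n s : size s = n -> multilin f ->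
  \sum_(e : n.-tuple bool) f (hparts gV e s) = f s.
Proof.
elim: n s f => [|n IH] [|x s] //= f; [move=> _ fl | move=> [sn] fl].
  rewrite (big_pred1 [tuple]) // => e; apply/esym/eqP; exact: tuple0.
rewrite (partition_big (fun e : n.+1.-tuple bool => thead e) xpredT) //=.
have step p : \sum_(e : n.+1.-tuple bool | thead e == p) f (hparts gV e (x :: s))
    = f (gpart gV p x :: s).
  rewrite -(IH s (fun l => f (gpart gV p x :: l))) //; last first.
    by move=> t1 t2 c y z; rewrite -!cat_cons fl.
  rewrite (reindex (fun e : n.-tuple bool => [tuple of p :: e])) /=; last first.
    exists (fun e : n.+1.-tuple bool => [tuple of behead e]) => e.
      by move=> _; apply: val_inj.
    by rewrite inE => /eqP <-; rewrite -tuple_eta.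
  by apply: eq_big => [e|e _]; rewrite ?theadE ?eqxx.
under eq_bigr => p _ do rewrite step.
rewrite big_bool /= -{3}(gpart_sum gV x).
have := fl [::] s 1 (gpart gV false x) (gpart gV true x).
by rewrite !scale1r /= => ->; rewrite addrC.
Qed.

(** In arity n, a cochain of parity P is purely of degree P + (n - 1), so one of its two components
    is everything and the other is zero. *)
Lemma hcomp_parity f P p s : multilinear_seq f -> has_parity gV P f ->
  hcomp gV p f s = if p == P (+) odd (size s).-1 then f s else 0.
Proof.
move=> fl fP; rewrite /hcomp /hcomp_at.
under eq_bigr => e _ do
  rewrite (gpart_homog _ (fP e s (size_tuple e))) (inj_eq (@addIb _)).
case: ifP => _; last by rewrite big1.
exact: (@sum_hparts V f _ s erefl fl).
Qed.

End HomogeneousSequences.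

(** * Permuted arguments and Koszul signs *)

Section Permutations.

Lemma permute1 (T : Type) (x0 : T) n (s : seq T) : size s = n ->
  permute x0 (1%g : 'S_n) s = s.
Proof.
move=> sn; apply: (@eq_from_nth _ x0) => [|i]; rewrite size_permute // => ilt.
by rewrite -[i]/(nat_of_ord (Ordinal ilt)) nth_permute perm1.
Qed.

Lemma permute_map (T U : Type) (x0 : T) (y0 : U) (h : T -> U) n (sigma : 'S_n)
  (s : seq T) : size s = n ->
  permute y0 sigma [seq h x | x <- s] = [seq h x | x <- permute x0 sigma s].
Proof.
move=> sn; rewrite /permute -map_comp; apply: eq_map => i /=.
by rewrite (nth_map x0) ?sn.
Qed.

(** Follows one argument through a permutation: its neighbours [r1], [r2] do not depend on its
    value, so linearity or a scalar in that argument can be tracked. *)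
Lemma permute_split (T : Type) (d : T) n (sigma : 'S_n) (x0 : 'I_n) (s1 s2 : seq T) :
  size s1 = sigma x0 -> (size s1 + (size s2).+1)%N = n ->
  exists r1 r2, [/\ size r1 = x0, (x0 + (size r2).+1)%N = n
    & forall x, permute d sigma (s1 ++ x :: s2) = r1 ++ x :: r2].
Proof.
move=> s1s sn; pose P x := permute d sigma (s1 ++ x :: s2).
exists (take x0 (P d)), (drop x0.+1 (P d)).
have x0n := ltn_ord x0.
rewrite size_take size_drop size_permute x0n; split=> // [|x]; first by lia.
apply: (@eq_from_nth _ d) => [|i].
  by rewrite size_cat /= size_take size_drop !size_permute x0n; lia.
rewrite size_permute => ilt.
rewrite nth_cat size_take size_permute x0n.
rewrite -[i in LHS]/(nat_of_ord (Ordinal ilt)) nth_permute.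
have nthP j (jlt : (j < n)%N) : j != x0 :> nat ->
    nth d (s1 ++ x :: s2) (sigma (Ordinal jlt)) = nth d (P d) j.
  move=> jx; rewrite -[in RHS]/(nat_of_ord (Ordinal jlt)) nth_permute !nth_cat.
  case: ltnP => // le; case E: (_ - _)%N => [|m] //.
  have /val_inj/perm_inj/(congr1 val)/= : val (sigma (Ordinal jlt)) = sigma x0.
    by rewrite /= -s1s; lia.
  by move/eqP: jx.
case: ltnP => le; first by rewrite nth_take // nthP //; lia.
case E: (i - x0)%N => [|m] /=.
  have -> : Ordinal ilt = x0 by apply: val_inj => /=; lia.
  by rewrite nth_cat s1s ltnn subnn.
by rewrite nth_drop nthP; [congr nth; lia | lia].
Qed.

Lemma deg_cat e1 e2 : deg (e1 ++ e2) = (deg e1 + deg e2)%N.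
Proof. exact: count_cat. Qed.

Lemma deg_drop m e : deg (drop m e) = (\sum_(i < size e | m <= i) nth false e i)%N.
Proof.
elim: e m => [|c e IH] m; first by rewrite big_ord0.
rewrite big_mkcond big_ord_recl /=; case: m => [|m] /=.
  by rewrite -[e in LHS](@drop0 _ e) -/(deg _) IH big_mkcond.
by rewrite IH add0n [in LHS]big_mkcond.
Qed.

Lemma deg_permute n (sigma : 'S_n) e : size e = n ->
  deg (permute false sigma e) = deg e.
Proof.
move=> en; have degE e' : size e' = n -> deg e' = (\sum_(i < n) nth false e' i)%N.
  by move=> <-; rewrite -{1}(drop0 e') deg_drop.
rewrite !degE ?size_permute // [RHS](reindex_perm sigma) /=.
by apply: eq_bigr => i _; rewrite nth_permute.
Qed.

Lemma koszul_sum (R : comPzRingType) n (sigma : 'S_n) e :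
  koszul R sigma e = (-1) ^+ (\sum_(x < n) \sum_(y < n | (x < y)%N && (sigma y < sigma x)%N)
     nth false e (sigma x) * nth false e (sigma y)).
Proof.
by rewrite /koszul expr_sum; apply: eq_bigr => x _; rewrite expr_sum.
Qed.

Lemma koszul1 (R : comPzRingType) n e : koszul R (1%g : 'S_n) e = 1.
Proof.
rewrite koszul_sum big1 // => x _; rewrite big_pred0 // => y.
by rewrite !perm1; lia.
Qed.

(* Changing the degree of one argument by p multiplies the Koszul sign by      *)
(* (-1)^p for each odd argument that is exchanged with it; modulo 2 those are  *)
(* the ones after it before the permutation plus the ones after it afterwards. *)
Lemma koszul_shift (R : comPzRingType) n (sigma : 'S_n) (x0 : 'I_n) (p e0 : bool)
    e1 e2 f1 f2 :
  size e1 = sigma x0 -> (size e1 + (size e2).+1)%N = n -> size f1 = x0 ->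
  permute false sigma (e1 ++ e0 :: e2) = f1 ++ e0 :: f2 ->
  koszul R sigma (e1 ++ (e0 (+) p) :: e2) =
    (-1) ^+ (p * (deg e2 + deg f2)) * koszul R sigma (e1 ++ e0 :: e2).
Proof.
set e := e1 ++ e0 :: e2; set e' := e1 ++ _ => se1 en sf1 pe.
have sze : size e = n by rewrite size_cat.
pose E (x : 'I_n) : nat := nth false e (sigma x).
have E'E x : nth false e' (sigma x) = nth false e (sigma x) (+) (p && (x == x0)).
  rewrite /e' /e !nth_cat se1 -(inj_eq (@perm_inj _ sigma)) -val_eqE /=.
  case: ltngtP => h /=; first by rewrite andbF addbF.
    by rewrite andbF addbF; case: (_ - _)%N (subn_gt0 (sigma x0) (sigma x)) => [|m]; rewrite ?h.
  by rewrite h subnn /= andbT.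
have degf2 : deg f2 = (\sum_(z < n | (x0 < z)%N) E z)%N.
  have -> : f2 = drop x0.+1 (permute false sigma e).
    by rewrite pe drop_cat -sf1 ltnNge leqnSn /= subSn // subnn /= drop0.
  by rewrite deg_drop size_permute; apply: eq_bigr => z _; rewrite nth_permute.
have dege2 : deg e2 = (\sum_(z < n | (sigma x0 < sigma z)%N) E z)%N.
  have -> : e2 = drop (sigma x0).+1 e.
    by rewrite /e drop_cat -se1 ltnNge leqnSn /= subSn // subnn /= drop0.
  rewrite deg_drop sze (reindex_perm sigma) /=.
  by apply: eq_bigr => z _.
pose inv (x y : 'I_n) := (x < y)%N && (sigma y < sigma x)%N.
pose A := (\sum_(z < n | inv x0 z) E z)%N.
pose B := (\sum_(z < n | inv z x0) E z)%N.
(* An argument that comes after the chosen one on exactly one side of the permutation is exchanged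
   with it; one that comes after it on both sides is counted twice, which is invisible modulo 2. *)
have AB : (A + B + 2 * \sum_(z < n | (x0 < z)%N && (sigma x0 < sigma z)%N) E z
           = deg e2 + deg f2)%N.
  rewrite degf2 dege2 /A /B big_distrr /= !(big_mkcond (fun _ => _ && _)) /=.
  rewrite !(big_mkcond (fun _ : 'I_n => leq _ _)) /= -!big_split /=.
  apply: eq_bigr => z _; rewrite /inv.
  have : (z == x0 :> nat) = (sigma z == sigma x0 :> nat).
    by rewrite !val_eqE (inj_eq perm_inj).
  by case: (ltngtP z x0); case: (ltngtP (sigma z) (sigma x0)) => //=; lia.
rewrite !koszul_sum -exprD; apply: eq_sign; rewrite [RHS]oddD.
have -> : odd (p * (deg e2 + deg f2)) = odd (p * (A + B)).
  by rewrite -AB !oddM oddD oddM /= addbF.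
rewrite -[RHS]oddD.
have -> : (p * (A + B) =
    \sum_(x < n) \sum_(y < n | inv x y) (p * ((x == x0) * E y + (y == x0) * E x)))%N.
  under eq_bigr => x _ do rewrite -big_distrr big_split /=.
  rewrite -big_distrr big_split /=; congr (_ * (_ + _))%N.
    rewrite (bigD1 x0) //= [X in (_ + X)%N]big1 ?addn0.
      by apply: eq_bigr => y _; rewrite eqxx mul1n.
    by move=> x /negPf xx0; rewrite big1 // => y _; rewrite xx0.
  rewrite (exchange_big_dep xpredT) //= (bigD1 x0) //= [X in (_ + X)%N]big1 ?addn0.
    by apply: eq_bigr => y _; rewrite eqxx mul1n.
  by move=> x /negPf xx0; rewrite big1 // => y _; rewrite xx0.
rewrite -big_split /= !(big_morph odd oddD (erefl : odd 0 = false)).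
apply: eq_bigr => x _; rewrite -big_split /= !(big_morph odd oddD (erefl : odd 0 = false)).
apply: eq_bigr => y /andP [xy _]; rewrite !E'E /E.
(* At most one factor of each product of degrees is shifted, so the exponent changes linearly in
   [p]. *)
have : ~~ ((x == x0) && (y == x0)).
  by apply/negP => /andP [/eqP h1 /eqP h2]; move: xy; rewrite h1 h2 ltnn.
case: (x == x0); case: (y == x0); rewrite //= ?andbT ?andbF ?addbF;
  by case: p {E'E e'}; do 2 case: (nth _ _ _).
Qed.

End Permutations.

Lemma split_take (T : Type) j (s : seq T) : (j <= size s)%N ->
  exists s1 s2, s = s1 ++ s2 /\ size s1 = j.
Proof.
by move=> js; exists (take j s), (drop j s); rewrite cat_take_drop size_takel.
Qed.

Lemma split3 (T : Type) j b (s : seq T) : (j + b <= size s)%N ->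
  exists s1 s2 s3, [/\ s = s1 ++ s2 ++ s3, size s1 = j & size s2 = b].
Proof.
move=> jb; exists (take j s), (take b (drop j s)), (drop b (drop j s)).
by rewrite !cat_take_drop !size_takel ?size_drop; [|lia..].
Qed.

(** * Brackets as sums of compositions *)

Section Composition.
Variables (k : fieldType) (V : lmodType k) (gV : z2grading V) (t : inf_type).
Implicit Types (f g : seq V -> V) (e : seq bool).

Definition comp_at (j b : nat) f g (s : seq V) : V :=
  f (take j s ++ g (take b (drop j s)) :: drop (j + b) s).

Lemma comp_at_cat j b f g s1 s2 s3 : size s1 = j -> size s2 = b ->
  comp_at j b f g (s1 ++ s2 ++ s3) = f (s1 ++ g s2 :: s3).
Proof.
move=> <- <-; rewrite /comp_at take_size_cat // drop_size_cat // take_size_cat //.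
by rewrite catA drop_size_cat ?size_cat.
Qed.

(** The argument [x] sits before, inside or after the block fed to [g]. In each case the rest of the
    expression is independent of [x]; multilinearity and extraction of scalars both rest on this
    case distinction. *)
Lemma comp_at_slot j b n f g (s1 s2 : seq V) :
    (j + b <= n)%N -> (size s1 + (size s2).+1)%N = n ->
  [\/ exists u m w, [/\ s2 = u ++ m ++ w, (size s1 + (size u).+1)%N = j, size m = b &
        forall x, comp_at j b f g (s1 ++ x :: s2) = f (s1 ++ x :: u ++ g m :: w)],
      exists u m1 m2 w, [/\ s1 = u ++ m1, s2 = m2 ++ w, size u = j,
        (size m1 + (size m2).+1)%N = b &
        forall x, comp_at j b f g (s1 ++ x :: s2) = f (u ++ g (m1 ++ x :: m2) :: w)]
    | exists u m w, [/\ s1 = u ++ m ++ w, size u = j, size m = b &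
        forall x, comp_at j b f g (s1 ++ x :: s2) = f ((u ++ g m :: w) ++ x :: s2)]].
Proof.
move=> jb sn; have [j1|j1] := ltnP (size s1) j.
  have [|u [r [s2E su]]] := @split_take _ (j - (size s1).+1) s2; first by lia.
  have [|m [w [rE sm]]] := @split_take _ b r.
    by move: sn; rewrite s2E size_cat; lia.
  apply: Or31; exists u, m, w; split=> [||//|x]; [by rewrite s2E rE | lia |].
  rewrite s2E rE -cat_cons catA comp_at_cat ?size_cat /=; [|lia|by []].
  by rewrite -catA.
have [u [r [s1E su]]] := split_take j1.
have [jb1|jb1] := ltnP (size s1) (j + b).
  have [|m2 [w [s2E sm2]]] := @split_take _ (j + b - (size s1).+1) s2; first by lia.
  apply: Or32; exists u, r, m2, w; move: jb1 sm2; rewrite s1E size_cat su => jb1 sm2.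
  split=> //; first by lia.
  move=> x; rewrite s2E -catA -cat_cons [r ++ _]catA comp_at_cat //.
  by rewrite size_cat /=; lia.
have [|m [w [rE sm]]] := @split_take _ b r.
  by move: jb1; rewrite s1E size_cat; lia.
apply: Or33; exists u, m, w; rewrite s1E rE; split=> // x.
by rewrite -!catA comp_at_cat // -catA.
Qed.

Lemma comp_at_multilinear j b f g (s1 s2 : seq V) (c : k) x y :
  multilinear_seq f -> multilinear_seq g -> (j + b <= size s1 + (size s2).+1)%N ->
  comp_at j b f g (s1 ++ (c *: x + y) :: s2) =
    c *: comp_at j b f g (s1 ++ x :: s2) + comp_at j b f g (s1 ++ y :: s2).
Proof.
move=> fl gl jb; have [] := comp_at_slot f g jb erefl.
- by move=> [u [m [w [_ _ _ E]]]]; rewrite !E fl.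
- by move=> [u [m1 [m2 [w [_ _ _ _ E]]]]]; rewrite !E gl fl.
- by move=> [u [m [w [_ _ _ E]]]]; rewrite !E fl.
Qed.

(** A composition sees [f] and [g] in one arity each, so they may be replaced by maps agreeing with
    them there. *)
Lemma comp_at_ext j b f g f' g' s :
  (j + b <= size s)%N ->
  (forall r, size r = (size s - b).+1 -> f r = f' r) ->
  (forall r, size r = b -> g r = g' r) ->
  comp_at j b f g s = comp_at j b f' g' s.
Proof.
move=> jb ff gg; rewrite /comp_at gg; last first.
  by rewrite size_takel // size_drop; lia.
by rewrite ff // size_cat /= size_drop size_take; case: ltnP; lia.
Qed.

(* The two types of brackets only differ in the range of [(sigma, j)]. *)
Definition adm (b n : nat) (sigma : 'S_n) : bool :=
  if t is Ainf then sigma == 1%g else shuffle b sigma.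
Definition width (a : nat) : nat := if t is Ainf then a else 1%N.

(** One formula for both types: the permutation factors are 1 in the A case, where [sigma] is the
    identity, and the last factor is 1 in the L case, where [j] is 0. *)
Definition ins_sign (n b : nat) (q : bool) e (sigma : 'S_n) (j : nat) : k :=
  (-1) ^+ sigma * koszul k sigma e *
  (-1) ^+ (q * deg (take j (permute false sigma e)) + j * b.-1).

Lemma insertE n a b q f g e s : size e = n -> size s = n ->
  insert t a b q f g e s =
    \sum_(sigma : 'S_n | adm b sigma) \sum_(0 <= j < width a)
      ins_sign b q e sigma j *: comp_at j b f g (permute 0 sigma s).
Proof.
rewrite /ins_sign /adm /width => en sn; case: t => /=.
  rewrite big_pred1_eq odd_perm1 koszul1 !mul1r !permute1 //.
  by apply: eq_bigr => j _; rewrite !mul1r.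
rewrite /insertL; case: _ / sn; apply: eq_bigr => sigma _.
by rewrite big_nat1 /comp_at !take0 /deg /= muln0 mul0n expr0 mulr1 drop0.
Qed.

(** The unshifted degree of the component of arity [n - i] of a cochain of parity [Q]. *)
Definition ins_parity (n i : nat) (Q : bool) : bool := Q (+) odd (n - i).-1.

(* The part of the modified bracket {f, g} of f and of g (of parity Q) where g *)
(* is inserted into f, on homogeneous arguments s of degrees e.                *)
Definition circ (Q : bool) f g e s : V :=
  \sum_(i < size s) (-1) ^+ (i * ins_parity (size s) i Q) *:
    insert t i.+1 (size s - i) (ins_parity (size s) i Q) f g e s.

Definition circ_sign (n : nat) (Q : bool) e (i : nat) (sigma : 'S_n) (j : nat) : k :=
  (-1) ^+ (i * ins_parity n i Q) * ins_sign (n - i) (ins_parity n i Q) e sigma j.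

Lemma circE n Q f g e s : size e = n -> size s = n ->
  circ Q f g e s =
    \sum_(i < n) \sum_(sigma : 'S_n | adm (n - i) sigma) \sum_(j < width i.+1)
      circ_sign Q e i sigma j *: comp_at j (n - i) f g (permute 0 sigma s).
Proof.
move=> en sn; rewrite /circ sn; apply: eq_bigr => i _.
rewrite (insertE _ _ _ _ _ en sn) scaler_sumr; apply: eq_bigr => sigma _.
by rewrite big_mkord scaler_sumr; apply: eq_bigr => j _; rewrite scalerA.
Qed.

Lemma width_le i (j : 'I_(width i.+1)) : (j <= i)%N.
Proof. by case: j => j /=; rewrite /width; case: t => jlt; lia. Qed.

(** The degrees [e] that determine the signs are passed separately from the arguments, so each term
    is linear by [comp_at_multilinear]. *)
Lemma circ_multilinear Q f g e s1 s2 (c : k) x y :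
  multilinear_seq f -> multilinear_seq g -> size e = (size s1 + (size s2).+1)%N ->
  circ Q f g e (s1 ++ (c *: x + y) :: s2) =
    c *: circ Q f g e (s1 ++ x :: s2) + circ Q f g e (s1 ++ y :: s2).
Proof.
move=> fl gl en; rewrite !(circE _ _ _ en) ?size_cat //.
rewrite scaler_sumr -big_split /=; apply: eq_bigr => i _.
rewrite scaler_sumr -big_split /=; apply: eq_bigr => sigma _.
rewrite scaler_sumr -big_split /=; apply: eq_bigr => j _.
rewrite [c *: (_ *: _)]scalerA [c * _]mulrC -[(_ * c) *: _]scalerA -scalerDr.
congr (_ *: _).
have ilt := ltn_ord i.
have i0lt : (size s1 < size s1 + (size s2).+1)%N by lia.
have [||r1 [r2 [_ sr2 E]]] := @permute_split _ 0 _ sigma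
  (sigma^-1%g (Ordinal i0lt)) s1 s2; rewrite ?permKV //.
rewrite !E comp_at_multilinear //.
have := congr1 size (E 0); rewrite size_permute size_cat /= => <-.
have := width_le j; lia.
Qed.

End Composition.

(** * The modified bracket as a graded commutator *)

Section BracketParity.
Variables (k : fieldType) (V : lmodType k) (gV : z2grading V) (t : inf_type).
Implicit Types (f g : seq V -> V) (e : seq bool).

(** For cochains of definite parity, the sum over degrees in [bracket] retains only one pair of
    degrees for each pair of arities. *)
Lemma insert_hcomp n a b P Q p q r f g e s :
  multilinear_seq f -> multilinear_seq g ->
  has_parity gV P f -> has_parity gV Q g ->
  size e = n -> size s = n -> (a + b)%N = n ->
  insert t a.+1 b r (hcomp gV p f) (hcomp gV q g) e s =
    ((p == P (+) odd a) && (q == Q (+) odd b.-1))%:R *: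
      insert t a.+1 b r f g e s.
Proof.
move=> fl gl fP gQ en sn abn; rewrite !(insertE _ _ _ _ _ _ en sn) scaler_sumr.
apply: eq_bigr => sigma _; rewrite !big_mkord scaler_sumr; apply: eq_bigr => j _.
rewrite [RHS]scalerA [_%:R * _]mulrC -[RHS]scalerA; congr (_ *: _).
have jb : (j + b <= size (permute 0%R sigma s))%N.
  by rewrite size_permute; have := width_le j; lia.
rewrite (@comp_at_ext _ _ _ _ _ _ (fun r => (p == P (+) odd a)%:R *: f r)
  (fun r => (q == Q (+) odd b.-1)%:R *: g r)) //.
- rewrite /comp_at -[_ *: g _]addr0 fl -(cat0s (take j _)) -catA.
  rewrite [X in _ + X]multilinear_seq0 ?addr0 //.
  by rewrite scalerA -natrM mulnb.
- move=> l; rewrite size_permute -abn addnK => sl; rewrite (hcomp_parity _ _ fl fP) sl /=.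
  by case: eqP => _; rewrite ?scale1r ?scale0r.
- move=> l sl; rewrite (hcomp_parity _ _ gl gQ) sl /=.
  by case: eqP => _; rewrite ?scale1r ?scale0r.
Qed.

(** The modifying sign in {f, g} is what replaces the arity-dependent sign of the second sum of
    [f, g] by the uniform sign (-1)^(PQ) of a graded commutator. *)
Lemma bracket_circ P Q f g s : multilinear_seq f -> multilinear_seq g ->
  has_parity gV P f -> has_parity gV Q g ->
  bracket gV t f g s = \sum_(e : (size s).-tuple bool)
    (circ t Q f g e (hparts gV e s) - (-1) ^+ (P * Q) *: circ t P g f e (hparts gV e s)).
Proof.
move=> fl gl fP gQ; rewrite /bracket; set n := size s.
transitivity (\sum_(i < n) \sum_(e : n.-tuple bool)
  (-1) ^+ (i * ins_parity n i Q) *: hbracket t i.+1 (n - i) (P (+) odd i)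
    (ins_parity n i Q) f g e (hparts gV e s)).
  apply: eq_bigr => i _; have ilt := ltn_ord i.
  have hb p q (e : n.-tuple bool) :
      hbracket t i.+1 (n - i) p q (hcomp gV p f) (hcomp gV q g) e (hparts gV e s)
      = ((p == P (+) odd i) && (q == ins_parity n i Q))%:R *:
        hbracket t i.+1 (n - i) p q f g e (hparts gV e s).
    have sh : size (hparts gV e s) = n by rewrite size_hparts ?size_tuple.
    rewrite /hbracket /ins_parity.
    rewrite (insert_hcomp _ _ _ fl gl fP gQ (size_tuple e) sh); last by lia.
    have -> : (n - i)%N = (n - i.+1).+1 by lia.
    rewrite (insert_hcomp _ _ _ gl fl gQ fP (size_tuple e) sh); last by lia.
    rewrite /= [(q == _) && _]andbC scalerBr; congr (_ - _).
    by rewrite !scalerA mulrC.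
  rewrite (bigD1 (P (+) odd i)) //= [X in _ + X]big1 ?addr0; last first.
    move=> p /negPf pP; rewrite big1 // => q _; rewrite big1 // => e _.
    by rewrite hb pP scale0r scaler0.
  rewrite (bigD1 (ins_parity n i Q)) //= [X in _ + X]big1 ?addr0; last first.
    by move=> q /negPf qQ; rewrite big1 // => e _; rewrite hb qQ andbF scale0r scaler0.
  by apply: eq_bigr => e _; rewrite hb !eqxx scale1r.
rewrite exchange_big; apply: eq_bigr => e _ /=.
have sh : size (hparts gV e s) = n by rewrite size_hparts ?size_tuple.
rewrite /hbracket /circ sh; under eq_bigr => i _ do rewrite scalerBr.
rewrite big_split /= sumrN; congr (_ - _).
(* Exchanging the two maps exchanges the arities i + 1 and n - i, that is, i and n - i - 1. *)
rewrite (reindex_inj rev_ord_inj) /= scaler_sumr; apply: eq_bigr => i _.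
have ilt := ltn_ord i; have -> : (n - (n - i.+1))%N = i.+1 by lia.
have -> : (n - i.+1).+1 = (n - i)%N by lia.
rewrite !scalerA -!exprD /ins_parity.
have -> : (n - (n - i.+1)).-1 = i by lia.
have -> : (n - i).-1 = (n - i.+1)%N by lia.
congr (_ *: _). parity.
Qed.

Lemma circ0 Q f g e s1 s2 : multilinear_seq f -> multilinear_seq g ->
  size e = (size s1 + (size s2).+1)%N -> circ t Q f g e (s1 ++ 0 :: s2) = 0.
Proof.
move=> fl gl es; have := circ_multilinear t Q 1 0 0 fl gl es.
by rewrite !scale1r addr0 => /esym/eqP; rewrite -subr_eq0 addrK => /eqP.
Qed.

(** A homogeneous argument projected to the wrong degree is 0. Hence a sum over multidegrees has a
    single surviving term on homogeneous arguments. *)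
Lemma hparts_mismatch e e' s : size e = size s -> hseq gV e' s -> e != e' ->
  exists s1 s2, hparts gV e s = s1 ++ 0 :: s2.
Proof.
elim: e e' s => [|p e IH] [|p' e'] [|v s] //= es; try by move=> /hseq_size.
case: es => es;
move=> /hseq_cons [hv hs]; rewrite /hparts /= (gpart_homog _ hv) eqseq_cons.
case: (eqVneq p p') => [_|_ _] /=; last by exists [::]; eexists.
by move/(IH _ _ es hs) => [s1 [s2 E]]; exists (v :: s1), s2; rewrite cat_cons -E.
Qed.

Lemma sum_hparts_hseq (U : zmodType) (X : seq bool -> seq V -> U) e s n :
  size s = n -> hseq gV e s ->
  (forall e' s1 s2, size e' = n -> (size s1 + (size s2).+1)%N = n ->
     X e' (s1 ++ 0 :: s2) = 0) ->
  \sum_(e' : n.-tuple bool) X e' (hparts gV e' s) = X e s.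
Proof.
move=> sn hs X0; have en : size e == n by rewrite (hseq_size hs) sn.
rewrite (bigD1 (Tuple en)) //= big1 ?addr0 ?(proj2 hs) // => e' e'e.
have [|s1 [s2 E]] := @hparts_mismatch e' e s _ hs e'e; first by rewrite size_tuple.
rewrite E X0 ?size_tuple //.
by have := congr1 size E; rewrite size_hparts ?size_tuple // size_cat sn.
Qed.

Lemma bracket_hseq P Q f g e s : multilinear_seq f -> multilinear_seq g ->
  has_parity gV P f -> has_parity gV Q g -> hseq gV e s ->
  bracket gV t f g s = circ t Q f g e s - (-1) ^+ (P * Q) *: circ t P g f e s.
Proof.
move=> fl gl fP gQ hs; rewrite (bracket_circ _ fl gl fP gQ).
apply: (sum_hparts_hseq (X := fun e s => circ t Q f g e s - _ *: circ t P g f e s)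
  erefl hs) => e' s1 s2 e's sn.
by rewrite !circ0 ?e's ?sn // scaler0 subr0.
Qed.

Lemma bracket_hparts P Q f g s : multilinear_seq f -> multilinear_seq g ->
  has_parity gV P f -> has_parity gV Q g ->
  bracket gV t f g s = \sum_(e : (size s).-tuple bool) bracket gV t f g (hparts gV e s).
Proof.
move=> fl gl fP gQ; rewrite (bracket_circ _ fl gl fP gQ).
apply: eq_bigr => e _; rewrite (bracket_hseq fl gl fP gQ (e := e)) //.
exact/hseq_hparts/size_tuple.
Qed.

End BracketParity.

Lemma multilinear_seqZ (k : fieldType) (V : lmodType k) (f : seq V -> V) s1 s2 c x :
  multilinear_seq f -> f (s1 ++ (c *: x) :: s2) = c *: f (s1 ++ x :: s2).
Proof.
by move=> fl; rewrite -{1}[c *: x]addr0 fl [X in _ + X]multilinear_seq0 ?addr0.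
Qed.

Lemma hseq_permute (k : fieldType) (V : lmodType k) (gV : z2grading V) n
  (sigma : 'S_n) e s : size s = n -> hseq gV e s ->
  hseq gV (permute false sigma e) (permute 0 sigma s).
Proof.
move=> sn /hseqP [_ h]; apply/hseqP; rewrite !size_permute; split=> // i ilt.
by rewrite -[i]/(nat_of_ord (Ordinal ilt)) !nth_permute; apply: h; rewrite sn.
Qed.

(** * Scalars *)

Section Contraction.
Variables (k : fieldType) (V : lmodType k) (S : falgType k) (c : {linear S -> k^o}).

(** The map 1 (x) c without sign; the sign of the pairing is carried separately by [twist]. *)
Definition contract (x : tens V S) : V := tens_lift (fun v u => (c u : k) *: v) x.

Lemma contract_bil_l (u : S) : linear (fun v : V => (c u : k) *: v).
Proof. by move=> a x y; rewrite scalerDr !scalerA mulrC. Qed.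

Lemma contract_bil_r (v : V) : linear (fun u : S => (c u : k) *: v).
Proof. by move=> a x y; rewrite linearP scalerDl scalerA. Qed.

Lemma contract_linear : linear contract.
Proof. exact: (tens_lift_linear contract_bil_l). Qed.
HB.instance Definition _ :=
  GRing.isLinear.Build k (tens V S) V *:%R contract contract_linear.

Lemma contractD x y : contract (x + y) = contract x + contract y.
Proof. exact: linearD. Qed.

Lemma contractZ a x : contract (a *: x) = a *: contract x.
Proof. exact: linearZ. Qed.

Lemma contract_ten v u : contract (ten v u) = (c u : k) *: v.
Proof. exact: (tens_liftE contract_bil_l contract_bil_r). Qed.

End Contraction.

Section Scalars.
Variables (k : fieldType) (V : lmodType k) (gV : z2grading V).
Variables (S : falgType k) (gS : z2grading S).
Local Notation T := (tens V S).
Local Notation gT := (tens_grading gV gS).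

Lemma tens_ind (P : T -> Prop) : P 0 -> (forall x y, P x -> P y -> P (x + y)) ->
  (forall v u, P (ten v u)) -> forall x, P x.
Proof. by move=> P0 PD Pt x; rewrite (tens_sum x); elim/big_ind: _. Qed.

Lemma gpart_ten p v u : gpart gT p (ten v u) =
  \sum_(q : bool) ten (gpart gV q v) (gpart gS (p (+) q) u).
Proof. exact: tens_part_ten. Qed.

(** A homogeneous tensor is a sum of pure tensors with homogeneous factors of the same total
    degree. *)
Lemma tens_homog_ind p (P : T -> Prop) : P 0 ->
  (forall x y, P x -> P y -> P (x + y)) ->
  (forall r v u, homog gV r v -> homog gS (p (+) r) u -> P (ten v u)) ->
  forall x, homog gT p x -> P x.
Proof.
move=> P0 PD Pt x <-; elim/tens_ind: x => [|x y Px Py|v u].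
- by rewrite linear0.
- by rewrite linearD; apply: PD.
rewrite gpart_ten; elim/big_ind: _ => // r _.
by apply: (Pt r); exact: homog_gpart.
Qed.

Lemma ten_sumr (I : Type) (r : seq I) (P : pred I) (v : V) (F : I -> S) :
  ten v (\sum_(i <- r | P i) F i) = \sum_(i <- r | P i) ten v (F i).
Proof. by rewrite (big_morph (ten v : S -> T) (tenDr v) (ten0r S v)). Qed.

Lemma ten_suml (I : Type) (r : seq I) (P : pred I) (F : I -> V) (u : S) :
  ten (\sum_(i <- r | P i) F i) u = \sum_(i <- r | P i) ten (F i) u.
Proof. by rewrite (big_morph (fun v : V => ten v u : T) (fun x y => tenDl x y u) (ten0l V u)). Qed.

Lemma tenZl c (v : V) (u : S) : ten (c *: v) u = c *: ten v u.
Proof. by rewrite -[c *: v]addr0 ten_linearl ten0l addr0. Qed.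

Lemma tenZr c (v : V) (u : S) : ten v (c *: u) = c *: ten v u.
Proof. by rewrite -[c *: u]addr0 ten_linearr ten0r addr0. Qed.

Lemma homog_ten p q v u : homog gV p v -> homog gS q u ->
  homog gT (p (+) q) (ten v u).
Proof.
move=> hv hu; rewrite /homog gpart_ten (bigD1 p) //= big1 ?addr0; last first.
  by move=> r /negPf rp; rewrite (gpart_homog _ hv) rp ten0l.
by rewrite hv (gpart_homog _ hu) addbC addKb eqxx.
Qed.

Lemma scale_bil_l (s u : S) : linear (fun v : V => ten v (u * s) : T).
Proof. by move=> c x y; rewrite ten_linearl. Qed.

Lemma scale_bil_r (s : S) v : linear (fun u : S => ten v (u * s) : T).
Proof. by move=> c x y; rewrite mulrDl -scalerAl ten_linearr. Qed.

Lemma tens_scale_ten v u s : tens_scale (ten v u) s = ten v (u * s) :> T.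
Proof.
by apply: (tens_liftE (B := fun v (u : S) => ten v (u * s) : T)) => ?;
  [exact: scale_bil_l | exact: scale_bil_r].
Qed.

Lemma tens_scale_linear s : linear ((@tens_scale _ V S)^~ s).
Proof. by apply: tens_lift_linear => u; apply: scale_bil_l. Qed.

Lemma tens_scale0l s : tens_scale (0 : T) s = 0.
Proof. by rewrite -{1}(ten0l V (0 : S)) tens_scale_ten ten0l. Qed.

Lemma tens_scaleDl x y s : tens_scale (x + y : T) s = tens_scale x s + tens_scale y s.
Proof. by have := tens_scale_linear s 1 x y; rewrite !scale1r. Qed.

Lemma tens_scaleZl c x s : tens_scale (c *: x : T) s = c *: tens_scale x s.
Proof.
by have := tens_scale_linear s c x 0; rewrite addr0 tens_scale0l addr0.
Qed.

Lemma tens_scale_suml (I : Type) (r : seq I) (P : pred I) (F : I -> T) s :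
  tens_scale (\sum_(i <- r | P i) F i) s = \sum_(i <- r | P i) tens_scale (F i) s.
Proof.
exact: (big_morph (@tens_scale _ V S ^~ s) (fun x y => tens_scaleDl x y s)
  (tens_scale0l s)).
Qed.

Lemma tens_scale_linearr (x : T) : linear (tens_scale x).
Proof.
move=> c s u; elim/tens_ind: x => [|x y hx hy|v w].
- by rewrite !tens_scale0l scaler0 addr0.
- by rewrite !tens_scaleDl hx hy scalerDr addrACA.
- by rewrite !tens_scale_ten mulrDr -scalerAr ten_linearr.
Qed.

Lemma tens_scale0r (x : T) : tens_scale x 0 = 0.
Proof.
have := tens_scale_linearr x 1 0 0; rewrite !scale1r addr0 => /esym/eqP.
by rewrite -subr_eq0 addrK => /eqP.
Qed.

Lemma tens_scaleZr (x : T) c s : tens_scale x (c *: s) = c *: tens_scale x s.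
Proof.
by have := tens_scale_linearr x c s 0; rewrite addr0 tens_scale0r addr0.
Qed.

Lemma tens_scaleA (x : T) s u : tens_scale (tens_scale x s) u = tens_scale x (s * u).
Proof.
elim/tens_ind: x => [|x y hx hy|v w].
- by rewrite !tens_scale0l.
- by rewrite !tens_scaleDl hx hy.
- by rewrite !tens_scale_ten mulrA.
Qed.

Lemma tens_scale1 (x : T) : tens_scale x 1 = x.
Proof.
elim/tens_ind: x => [|x y hx hy|v w].
- by rewrite tens_scale0l.
- by rewrite tens_scaleDl hx hy.
- by rewrite tens_scale_ten mulr1.
Qed.

Hypothesis hS : graded_commutative gS.

Lemma homog1 : homog gS false 1.
Proof. by case: hS. Qed.

Lemma homogM p q x y : homog gS p x -> homog gS q y -> homog gS (p (+) q) (x * y).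
Proof. by case: hS => _ h _; exact: h. Qed.

Lemma gmulC p q x y : homog gS p x -> homog gS q y ->
  x * y = (-1) ^+ (p * q) *: (y * x).
Proof.
case: hS => _ _ h hx hy; rewrite (h _ _ _ _ hx hy) -signr_odd mulr_sign.
by rewrite -(signr_odd k) scaler_sign.
Qed.

Lemma homog_scale p q (x : T) s : homog gT p x -> homog gS q s ->
  homog gT (p (+) q) (tens_scale x s).
Proof.
move=> hx hs; move: x hx; apply: tens_homog_ind => [|x y hx hy|r v u hv hu].
- by rewrite tens_scale0l; exact: homog0.
- by rewrite tens_scaleDl; exact: homogD.
- rewrite tens_scale_ten.
  have -> : p (+) q = r (+) ((p (+) r) (+) q) by case: p {hu}; case: q {hs}; case: r {hv}.
  exact: homog_ten hv (homogM hu hs).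
Qed.

Lemma homog_ten1 p v : homog gV p v -> homog gT p (ten v 1).
Proof. by move=> hv; rewrite -[p]addbF; exact: homog_ten hv homog1. Qed.

Lemma hseq_ten1 e s : hseq gV e s -> hseq gT e [seq ten v 1 | v <- s].
Proof.
elim: e s => [|p e IH] [|v s] //=; try by move=> /hseq_size.
by move=> /hseq_cons [hv hs]; apply/hseq_cons; split; [exact: homog_ten1 | exact: IH].
Qed.

Lemma tens_scaleC p q (x : T) s u : homog gS p s -> homog gS q u ->
  tens_scale (tens_scale x s) u = (-1) ^+ (p * q) *: tens_scale (tens_scale x u) s.
Proof.
move=> hs hu; rewrite !tens_scaleA (gmulC hs hu).
by rewrite tens_scaleZr.
Qed.

Variable tau : seq T -> T.
Hypotheses (taul : multilinear_seq tau) (taup : has_parity gT true tau).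
Hypothesis tauS : S_multilinear gV gS tau.

Lemma S_multilinear_hseq s1 x s2 e p u : homog gS p u -> hseq gT e s2 ->
  tau (s1 ++ tens_scale x u :: s2) = (-1) ^+ (p * deg e) *: tens_scale (tau (s1 ++ x :: s2)) u.
Proof. by move=> hu [es he]; have := tauS s1 x hu es; rewrite he. Qed.

(** The scalar passes every argument to its right. When [x] precedes the block, it passes the output
    of the inner [tau] instead, whose degree is that of the block plus [b], since the arity [b]
    component of an odd cochain has degree [b]. *)
Lemma comp_at_scale j b n s1 x e2 s2 p u :
  (0 < b)%N -> (j + b <= n)%N -> (size s1 + (size s2).+1)%N = n ->
  hseq gT e2 s2 -> homog gS p u ->
  comp_at j b tau tau (s1 ++ tens_scale x u :: s2) =
    (-1) ^+ (p * (deg e2 + (size s1 < j) * b)) *: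
      tens_scale (comp_at j b tau tau (s1 ++ x :: s2)) u.
Proof.
move=> b0 jb sn hs2 hu; have es2 := hseq_size hs2.
have [] := comp_at_slot tau tau jb sn.
- move=> [c [m [w [s2E sj sm E]]]]; rewrite !E.
  have [|fc [r [e2E sfc]]] := @split_take _ (size c) e2.
    by rewrite es2 s2E size_cat leq_addr.
  move: hs2; rewrite e2E s2E => /(hseq_cat _ _ _ sfc) [hc hr].
  have [|fm [fw [rE sfm]]] := @split_take _ (size m) r.
    by rewrite (hseq_size hr) size_cat leq_addr.
  move: hr; rewrite rE => /(hseq_cat _ _ _ sfm) [hm hw].
  rewrite (@S_multilinear_hseq _ _ _ (fc ++ (odd b (+) odd (deg fm)) :: fw) _ _ hu).
    have -> : (size s1 < j)%N by rewrite -sj addnS ltnS leq_addr.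
    by congr (_ *: _); rewrite !deg_cat /= -/(deg fw); parity.
  apply/hseq_cat; first by [].
  split=> //; apply/hseq_cons; split=> //.
  have := has_parity_homog taup hm; rewrite sm.
  by case: (b) b0 => //= b' _; rewrite negbK.
- move=> [c [m1 [m2 [w [s1E s2E sc sm E]]]]]; rewrite !E.
  have [|fm2 [fw [e2E sfm2]]] := @split_take _ (size m2) e2.
    by rewrite es2 s2E size_cat leq_addr.
  move: hs2; rewrite e2E s2E => /(hseq_cat _ _ _ sfm2) [hm2 hw].
  rewrite (S_multilinear_hseq _ _ hu hm2) multilinear_seqZ //.
  rewrite (S_multilinear_hseq _ _ hu hw) scalerA -exprD.
  have -> : (size s1 < j)%N = false by rewrite s1E size_cat sc ltnNge leq_addr.
  by congr (_ *: _); rewrite !deg_cat; parity.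
- move=> [c [m [w [s1E sc sm E]]]]; rewrite !E (S_multilinear_hseq _ _ hu hs2).
  have -> : (size s1 < j)%N = false by rewrite s1E size_cat sc ltnNge leq_addr.
  by congr (_ *: _); parity.
Qed.

(* The sign (-1)^(p q) from moving the scalar across the inserted map of degree *)
(* q cancels the change of the sign (-1)^(q deg) of the insertion, and the      *)
(* change of the Koszul sign accounts for the arguments exchanged by sigma.     *)
Lemma circ_scale t e1 s1 e0 x e2 s2 p u :
  hseq gT e1 s1 -> homog gT e0 x -> hseq gT e2 s2 -> homog gS p u ->
  circ t true tau tau (e1 ++ (e0 (+) p) :: e2) (s1 ++ tens_scale x u :: s2) =
    (-1) ^+ (p * deg e2) *:
      tens_scale (circ t true tau tau (e1 ++ e0 :: e2) (s1 ++ x :: s2)) u.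
Proof.
move=> hs1 hx hs2 hu; set n := (size s1 + (size s2).+1)%N.
have es1 := hseq_size hs1; have es2 := hseq_size hs2.
have hs : hseq gT (e1 ++ e0 :: e2) (s1 ++ x :: s2).
  by apply/hseq_cat => //; split=> //; apply/hseq_cons.
rewrite !(@circE _ _ _ n) ?size_cat /= ?es1 ?es2 //.
rewrite tens_scale_suml scaler_sumr; apply: eq_bigr => i _.
rewrite tens_scale_suml scaler_sumr; apply: eq_bigr => sigma _.
rewrite tens_scale_suml scaler_sumr; apply: eq_bigr => j _.
have i0lt : (size s1 < n)%N by rewrite /n; lia.
pose x0 := sigma^-1%g (Ordinal i0lt).
have [||r1 [r2 [sr1 sr2 Er]]] := @permute_split _ 0 _ sigma x0 s1 s2; rewrite ?permKV //.
have [||f1 [f2 [sf1 sf2 Ef]]] := @permute_split _ false _ sigma x0 e1 e2;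
  rewrite ?permKV ?es1 ?es2 //.
have := hseq_permute sigma _ hs; rewrite size_cat /= Er Ef => /(_ erefl).
move/(hseq_cat gT (e0 :: f2) (x :: r2)); rewrite sf1 sr1 => /(_ erefl) [_ /hseq_cons [_ hr2]].
have ilt := ltn_ord i; have jle := width_le j.
rewrite Er (@comp_at_scale _ _ n _ _ _ _ _ _ _ _ _ hr2 hu) ?sr1 //; [|lia..].
rewrite tens_scaleZl !scalerA; congr (_ *: _).
rewrite /circ_sign /ins_sign (@koszul_shift _ _ _ x0 p e0 e1 e2 f1 f2)
  ?permKV ?es1 ?es2 //.
rewrite !Ef.
(* The shifted degree enters the insertion sign only if the scaled argument lies to the left of the
   block, i.e. if [x0 < j]. *)
have -> : (-1) ^+ (ins_parity n i true * deg (take j (f1 ++ (e0 (+) p) :: f2))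
      + j * (n - i).-1) =
    (-1) ^+ (ins_parity n i true * deg (take j (f1 ++ e0 :: f2)) + j * (n - i).-1) *
    (-1) ^+ (ins_parity n i true * ((x0 < j) * p)) :> k.
  rewrite -exprD !take_cat sf1; case: (ltngtP j x0) => xj.
  - by rewrite !(muln0, mul0n, addn0).
  - have -> : (j - x0)%N = (j - x0.+1).+1 by lia.
    by rewrite /= !deg_cat /= -/(deg _); parity.
  - by rewrite xj subnn !(muln0, mul0n, addn0).
have -> : ins_parity n i true = odd (n - i).
  by rewrite /ins_parity; have -> : (n - i)%N = (n - i).-1.+1 by lia.
set a1 := (-1) ^+ sigma; set a2 := koszul _ _ _; set a3 := (-1) ^+ (_ + j * _).
set a4 := (-1) ^+ (i * _).
have <- : (-1) ^+ (p * (deg f2 + (x0 < j) * (n - i))) * ((-1) ^+ (p * (deg e2 + deg f2)) *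
    (-1) ^+ (odd (n - i) * ((x0 < j) * p))) = (-1) ^+ (p * deg e2) :> k.
  by rewrite -!exprD; case: (x0 < j)%N; parity.
move: a1 a2 a3 a4 (_ ^+ (p * (deg f2 + _))) (_ ^+ (p * _)) (_ ^+ (odd _ * _)).
by clear=> a1 a2 a3 a4 s1' s2' s3'; ring.
Qed.

End Scalars.

Lemma multilinear_seq_sum (k : fieldType) (V : lmodType k) (f : seq V -> V) s1 s2
    (I : Type) (r : seq I) (P : pred I) (F : I -> V) : multilinear_seq f ->
  f (s1 ++ (\sum_(i <- r | P i) F i) :: s2) = \sum_(i <- r | P i) f (s1 ++ F i :: s2).
Proof.
move=> fl; apply: (big_morph (fun x => f (s1 ++ x :: s2))) => [x y|].
  by rewrite -[x]scale1r fl !scale1r.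
exact: multilinear_seq0.
Qed.

(** * The square of [tau] in a homogeneous basis of S *)

Section HomogeneousBasis.
Variables (k : fieldType) (V : lmodType k) (gV : z2grading V).
Variables (S : falgType k) (gS : z2grading S) (hS : graded_commutative gS).
Local Notation T := (tens V S).
Local Notation gT := (tens_grading gV gS).

(** Each argument is a sum of tensors v (x) u = (v (x) 1) u, and [circ_scale] moves u out. The
    induction is on the arguments not yet reduced to the form v (x) 1. *)
Lemma circ_vanish t (tau : seq T -> T) :
  multilinear_seq tau -> has_parity gT true tau -> S_multilinear gV gS tau ->
  (forall e s, hseq gV e s -> circ t true tau tau e [seq ten v 1 | v <- s] = 0) ->
  forall e s, hseq gT e s -> circ t true tau tau e s = 0.
Proof.
move=> taul taup tauS tau0.
suff main e2 s2 : hseq gT e2 s2 -> forall e1 s1, hseq gV e1 s1 ->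
    circ t true tau tau (e1 ++ e2) ([seq ten v 1 | v <- s1] ++ s2) = 0.
  by move=> e s hs; exact: (main e s hs [::] [::] (hseq_nil _)).
elim: e2 s2 => [|p e2 IH] [|x s2]; try by move=> /hseq_size.
  by move=> _ e1 s1 hs1; rewrite !cats0; exact: tau0.
move=> /hseq_cons [hx hs2] e1 s1 hs1.
have hs1' := hseq_ten1 hS hs1; have es2 := hseq_size hs2.
have sz : size (e1 ++ p :: e2) = (size [seq ten v (1 : S) | v <- s1] + (size s2).+1)%N.
  by rewrite size_cat /= (hseq_size hs1') es2.
move: x hx; apply: tens_homog_ind => [|x y hx hy|r v u hv hu].
- by rewrite circ0.
- by rewrite -[x]scale1r circ_multilinear // scale1r hx hy addr0.
have -> : ten v u = tens_scale (ten v 1) u by rewrite tens_scale_ten mul1r.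
have {1}-> : p = r (+) (p (+) r) by case: (p); case: (r).
rewrite (circ_scale taul taup tauS _ hs1' (homog_ten1 hS hv) hs2 hu).
have := IH _ hs2 (rcons e1 r) (rcons s1 v); rewrite map_rcons !cat_rcons => ->.
  by rewrite tens_scale0l scaler0.
by rewrite -!cats1; apply/hseq_cat; [exact: hseq_size hs1 | split=> //; apply/hseq_cons].
Qed.

Variables (I : finType) (M : I -> S) (pI : I -> bool) (C : I -> {linear S -> k^o}).
Hypothesis CM : forall i j, C i (M j) = (i == j)%:R.
Hypothesis sumCM : forall u, u = \sum_i (C i u : k) *: M i.
Hypothesis homogMi : forall i, homog gS (pI i) (M i).

Lemma coord_homog q u i : homog gS q u -> q != pI i -> C i u = 0.
Proof.
move=> hu qi; rewrite -hu {1}(sumCM u) !linear_sum big1 // => j _ /=.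
rewrite linearZ /= (gpart_homog _ (homogMi j)) -[X in X = _]/(C i _).
have [qj|_] := eqVneq q (pI j); last by rewrite scaler0 linear0.
rewrite linearZ /= CM; have [ij|_] := eqVneq i j; last by rewrite scaler0.
by move: qi; rewrite ij qj eqxx.
Qed.

Lemma sum_contract (x : T) : x = \sum_i ten (contract (C i) x) (M i).
Proof.
elim/tens_ind: x => [|x y hx hy|v u].
- by rewrite big1 // => i _; rewrite linear0 ten0l.
- rewrite {1}hx {1}hy -big_split; apply: eq_bigr => i _ /=.
  by rewrite linearD tenDl.
- rewrite {1}(sumCM u) ten_sumr; apply: eq_bigr => i _.
  by rewrite contract_ten tenZl tenZr.
Qed.

Lemma homog_contract p i (x : T) : homog gT p x -> homog gV (p (+) pI i) (contract (C i) x).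
Proof.
move: x; apply: tens_homog_ind => [|x y hx hy|r v u hv hu].
- by rewrite linear0; exact: homog0.
- by rewrite linearD; exact: homogD.
rewrite contract_ten; have [<-|pi] := eqVneq (p (+) r) (pI i).
  by rewrite addKb; exact: homogZ.
by rewrite (coord_homog hu pi) scale0r; exact: homog0.
Qed.

Variables (t : inf_type) (tau : seq T -> T) (al : I -> seq V -> V).
Hypotheses (taul : multilinear_seq tau) (taup : has_parity gT true tau).
Hypothesis tauS : S_multilinear gV gS tau.
Hypotheses (alm : forall i, multilinear_seq (al i))
  (alp : forall i, has_parity gV (~~ pI i) (al i)).
(** The twist anticipates the sign in 1 (x) f, so that [al i] is the value of [alpha] on the dual
    basis vector with no sign left. *)
Hypothesis tau_ten1 : forall s,
  tau [seq ten v 1 | v <- s] = \sum_i ten (twist gV (pI i) (al i s)) (M i).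

(** The inner [tau] produces [M i], which leaves the outer [tau] across the arguments after the
    block; the outer one then contributes [M l] on its left. The exponent collects this passage and
    both twists. *)
Lemma comp_at_ten1 j b n e s : hseq gV e s -> size s = n -> (j + b <= n)%N -> (0 < b)%N ->
  comp_at j b tau tau [seq ten v 1 | v <- s] = \sum_l \sum_i
    (-1) ^+ (pI i * (deg e + deg (take j e) + b + pI i) + pI l * (pI l + n.+1 + deg e + pI i)) *:
      ten (comp_at j b (al l) (al i) s) (M l * M i).
Proof.
move=> hs sn; rewrite -sn => jb b0.
have [s1 [s2 [s3 [sE s1j s2b]]]] := split3 jb.
move: jb; rewrite -(hseq_size hs) => jb.
have [e1 [e2 [e3 [eE e1j e2b]]]] := split3 jb.
move: hs; rewrite sE eE => /(hseq_cat _ _ _ (etrans e1j (esym s1j))) [hs1].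
move=> /(hseq_cat _ _ _ (etrans e2b (esym s2b))) [hs2 hs3].
rewrite !map_cat comp_at_cat ?size_map // tau_ten1 multilinear_seq_sum // exchange_big.
apply: eq_bigr => i _.
have hi := has_parity_homog (alp i) hs2.
rewrite (twist_homog _ hi).
have -> : ten ((-1) ^+ (pI i * (~~ pI i (+) odd (size s2).-1 (+) odd (deg e2))) *: al i s2) (M i)
   = (-1) ^+ (pI i * (~~ pI i (+) odd (size s2).-1 (+) odd (deg e2))) *:
     (tens_scale (ten (al i s2) 1) (M i)) by rewrite tens_scale_ten mul1r tenZl.
rewrite multilinear_seqZ //.
rewrite (S_multilinear_hseq tauS _ _ (homogMi i) (hseq_ten1 hS hs3)).
rewrite -(map_cons (fun v : V => ten v (1 : S))) -map_cat tau_ten1 tens_scale_suml !scaler_sumr.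
apply: eq_bigr => l _; rewrite tens_scale_ten.
have h : hseq gV (e1 ++ (~~ pI i (+) odd (size s2).-1 (+) odd (deg e2)) :: e3)
    (s1 ++ al i s2 :: s3).
  by apply/hseq_cat; rewrite ?e1j //; split=> //; apply/hseq_cons.
rewrite (twist_homog _ (has_parity_homog (alp l) h)) tenZl !scalerA -!exprD.
rewrite comp_at_cat //; congr (_ *: _).
rewrite take_size_cat // !deg_cat /= -/(deg e3) !size_cat /= addnS /=.
rewrite (hseq_size hs1) (hseq_size hs2) (hseq_size hs3) s2b.
case: b b0 {s2b e2b jb} => // b _ /=.
by move: (pI i) (pI l) => x y; parity.
Qed.

(** The signs depending on arity, shuffle and position are absorbed in changing the parity of the
    inserted map from that of [tau] to that of [al i]; what remains depends only on degrees and on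
    the number of arguments. *)
Lemma circ_ten1 e s : hseq gV e s ->
  circ t true tau tau e [seq ten v 1 | v <- s] = \sum_l \sum_i
    (-1) ^+ ((pI i + pI l) * (deg e + size s) + pI i + pI l * pI i) *:
      ten (circ t (~~ pI i) (al l) (al i) e s) (M l * M i).
Proof.
move=> hs; have es := hseq_size hs; set n := size s in es *.
rewrite !(@circE _ _ _ n) ?size_map //.
under [RHS]eq_bigr => l _ do under eq_bigr => i _ do rewrite (@circE _ _ _ n) //
  ten_suml scaler_sumr.
under [RHS]eq_bigr => l _ do rewrite exchange_big /=.
rewrite [RHS]exchange_big; apply: eq_bigr => a _ /=.
under [RHS]eq_bigr => l _ do under eq_bigr => i _ do rewrite ten_suml scaler_sumr.
under [RHS]eq_bigr => l _ do rewrite exchange_big /=.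
rewrite [RHS]exchange_big; apply: eq_bigr => sigma _ /=.
under [RHS]eq_bigr => l _ do under eq_bigr => i _ do rewrite ten_suml scaler_sumr.
under [RHS]eq_bigr => l _ do rewrite exchange_big /=.
rewrite [RHS]exchange_big; apply: eq_bigr => j _ /=.
have alt := ltn_ord a; have jle := width_le j.
rewrite (permute_map 0) //.
rewrite (@comp_at_ten1 _ _ n _ _ (hseq_permute sigma erefl hs)) ?size_permute //; [|lia..].
rewrite !scaler_sumr; apply: eq_bigr => l _; rewrite !scaler_sumr.
apply: eq_bigr => i _; rewrite deg_permute //.
rewrite tenZl !scalerA; congr (_ *: _).
rewrite /circ_sign /ins_sign /ins_parity.
set X := (-1) ^+ sigma * _; move: X => X; rewrite ![X * _]mulrC !mulrA [_ * X * _]mulrAC -!exprD.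
congr (_ * _).
have [b nb] : exists b, (n - a = b.+1)%N by exists (n - a).-1; lia.
have on : odd n = odd a (+) ~~ odd b by rewrite -[~~ _]/(odd b.+1) -oddD; congr odd; lia.
rewrite nb /=; apply: eq_sign; rewrite !(oddD, oddM, oddS, oddb, mulnb) on.
by move: (pI i) (pI l) => x y; parity_cases.
Qed.

End HomogeneousBasis.

(** * S-multilinear extension *)

Section Extension.
Variables (k : fieldType) (V : lmodType k) (gV : z2grading V).
Variables (S : falgType k) (gS : z2grading S) (hS : graded_commutative gS).
Local Notation T := (tens V S).
Local Notation gT := (tens_grading gV gS).
Implicit Types (h : seq V -> T) (c p q r : bool) (s : seq T).

(* The S-multilinear extension of h: the scalar u of an argument v (x) u       *)
(* leaves to the right, and c is the total degree of the scalars which have    *)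
(* yet to pass the remaining arguments.                                        *)
Fixpoint ext h c s : T :=
  if s is x :: s' then
    tens_lift (fun v u => \sum_(q : bool)
      tens_scale (ext (fun l => h (v :: l)) (c (+) q) s') (gpart gS q u))
      (twist gT c x)
  else h [::].

(** The bilinear map lifted in the recursive case of [ext], named so that the universal property of
    the tensor product can be applied to it. *)
Definition extB h c s v u : T := \sum_(q : bool)
  tens_scale (ext (fun l => h (v :: l)) (c (+) q) s) (gpart gS q u).

Lemma ext_cons h c x s : ext h c (x :: s) = tens_lift (extB h c s) (twist gT c x).
Proof. by []. Qed.

Lemma extB_homog h c s v q u : homog gS q u ->
  extB h c s v u = tens_scale (ext (fun l => h (v :: l)) (c (+) q) s) u.
Proof.
move=> hu; rewrite /extB (bigD1 q) //= hu big1 ?addr0 // => r /negPf rq.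
by rewrite (gpart_homog _ hu) rq tens_scale0r.
Qed.

Lemma ext_linear a h h' c s :
  ext (fun l => a *: h l + h' l) c s = a *: ext h c s + ext h' c s.
Proof.
elim: s h h' c => [|x s IH] h h' c //=.
rewrite /tens_lift scaler_sumr -big_split; apply: eq_bigr => j _ /=.
rewrite scaler_sumr -big_split; apply: eq_bigr => q _ /=.
rewrite (IH (fun l => h (_ :: l)) (fun l => h' (_ :: l))).
by rewrite tens_scaleDl tens_scaleZl.
Qed.

Lemma ext_scalel a h c s : ext (fun l => a *: h l) c s = a *: ext h c s.
Proof.
(* This form lets [ext_linear] apply without treating the zero map separately. *)
have -> : (fun l => a *: h l) = (fun l => (a - 1) *: h l + h l).
  by apply/funext => l; rewrite scalerBl scale1r subrK.
by rewrite ext_linear scalerBl scale1r subrK.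
Qed.

Lemma multilin_cons h v : multilin h -> multilin (fun l => h (v :: l)).
Proof. by move=> hm s1 s2 a x y; rewrite -!cat_cons hm. Qed.

Lemma extB_bil_l h c s u : multilin h -> linear (fun v => extB h c s v u).
Proof.
move=> hm a x y; rewrite scaler_sumr -big_split; apply: eq_bigr => q _ /=.
have -> : (fun l => h ((a *: x + y) :: l)) = (fun l => a *: h (x :: l) + h (y :: l)).
  by apply/funext => l; exact: (hm [::]).
by rewrite ext_linear tens_scaleDl tens_scaleZl.
Qed.

Lemma extB_bil_r h c s v : linear (extB h c s v).
Proof.
move=> a x y; rewrite scaler_sumr -big_split; apply: eq_bigr => q _ /=.
by rewrite linearP tens_scale_linearr.
Qed.

Lemma extB_ten h c s v u : multilin h -> tens_lift (extB h c s) (ten v u) = extB h c s v u.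
Proof.
by move=> hm; apply: tens_liftE => ?; [exact: extB_bil_l | exact: extB_bil_r].
Qed.

Lemma ext_lift_linear h c s : multilin h -> linear (tens_lift (extB h c s)).
Proof. by move=> hm; apply: tens_lift_linear => u; exact: extB_bil_l. Qed.

Lemma ext_liftD h c s x y : multilin h -> tens_lift (extB h c s) (x + y) =
  tens_lift (extB h c s) x + tens_lift (extB h c s) y.
Proof. by move=> hm; rewrite -[x]scale1r ext_lift_linear // !scale1r. Qed.

Lemma ext_lift0 h c s : multilin h -> tens_lift (extB h c s) 0 = 0.
Proof.
move=> hm; have /esym/eqP := ext_liftD c s 0 0 hm.
by rewrite addr0 -subr_eq0 addrK => /eqP.
Qed.

Lemma ext_liftZ h c s a x : multilin h ->
  tens_lift (extB h c s) (a *: x) = a *: tens_lift (extB h c s) x.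
Proof.
by move=> hm; have := ext_lift_linear c s hm a x 0; rewrite ext_lift0 ?addr0.
Qed.

Lemma ext_multilinear h c : multilin h -> multilinear_seq (ext h c).
Proof.
move=> hm s1 s2 a x y; elim: s1 h c hm => [|z s1 IH] h c hm.
  by rewrite !cat0s !ext_cons linearP /= ext_lift_linear.
rewrite !cat_cons !ext_cons /tens_lift scaler_sumr -big_split; apply: eq_bigr => j _ /=.
rewrite scaler_sumr -big_split; apply: eq_bigr => q _ /=.
by rewrite IH ?tens_scaleDl ?tens_scaleZl //; exact: multilin_cons.
Qed.

(** An additional waiting scalar of degree [p] passes all remaining arguments. *)
Lemma ext_shift h c p e s : multilin h -> hseq gT e s ->
  ext h (c (+) p) s = (-1) ^+ (p * deg e) *: ext h c s.
Proof.
move=> hm; elim: s e h c hm => [|x s IH] [|e0 e] h c hm; try by move=> /hseq_size.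
  by rewrite muln0 scale1r.
move=> /hseq_cons [hx hs]; rewrite !ext_cons !(twist_homog _ hx).
rewrite !ext_liftZ //.
have -> : tens_lift (extB h (c (+) p) s) x =
    (-1) ^+ (p * deg e) *: tens_lift (extB h c s) x.
  rewrite /tens_lift scaler_sumr; apply: eq_bigr => j _.
  rewrite /extB scaler_sumr; apply: eq_bigr => q _.
  rewrite addbAC (IH e _ _ _ hs) ?tens_scaleZl //; exact: multilin_cons.
by rewrite !scalerA -!exprD; congr (_ *: _); rewrite /= -/(deg e); parity.
Qed.

Lemma tens_ind_homog (P : T -> Prop) : P 0 -> (forall x y, P x -> P y -> P (x + y)) ->
  (forall r q v u, homog gV r v -> homog gS q u -> P (ten v u)) -> forall x, P x.
Proof.
move=> P0 PD Pt x; rewrite -(gpart_sum gT x).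
by apply: (PD); apply: (tens_homog_ind P0 PD) (homog_gpart gT _ _) => r v u hv hu;
  exact: Pt hv hu.
Qed.

(** Scaling shifts the degree of [x], so the waiting scalars give (-1)^(pc) and the later arguments
    (-1)^(p deg e). For an earlier argument, commuting [u] with its scalar of degree [q] compensates
    the passage from [c] to [c (+) q]. *)
Lemma ext_scale h c s1 x s2 e p u : multilin h -> homog gS p u -> hseq gT e s2 ->
  ext h c (s1 ++ tens_scale x u :: s2) =
    (-1) ^+ (p * (c + deg e)) *: tens_scale (ext h c (s1 ++ x :: s2)) u.
Proof.
move=> hm hu hs2; elim: s1 h c hm => [|y s1 IH] h c hm.
  rewrite !cat0s !ext_cons.
  move: x; apply: tens_ind_homog => [|x y hx hy|r q v w hv hw].
  - by rewrite !(tens_scale0l, linear0) /= ext_lift0 // tens_scale0l scaler0.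
  - rewrite tens_scaleDl !twistD.
    rewrite (ext_liftD c s2 (twist gT c _) (twist gT c _) hm) hx hy.
    rewrite (ext_liftD c s2 (twist gT c _) (twist gT c _) hm).
    by rewrite tens_scaleDl scalerDr.
  rewrite tens_scale_ten (twist_homog _ (homog_ten hv (homogM hS hw hu))).
  rewrite (twist_homog _ (homog_ten hv hw)).
  rewrite !ext_liftZ // !extB_ten //.
  rewrite (extB_homog _ _ _ _ (homogM hS hw hu)) (extB_homog _ _ _ _ hw).
  rewrite [c (+) (_ (+) _)]addbA (ext_shift (c (+) q) p (multilin_cons v hm) hs2).
  rewrite !tens_scaleZl tens_scaleA !scalerA -!exprD; congr (_ *: _); parity.
rewrite !cat_cons !ext_cons /tens_lift tens_scale_suml scaler_sumr.
apply: eq_bigr => j _; rewrite /extB tens_scale_suml scaler_sumr; apply: eq_bigr => q _.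
rewrite IH; last exact: multilin_cons.
rewrite tens_scaleZl (tens_scaleC hS _ hu (homog_gpart gS q _)) scalerA -exprD.
congr (_ *: _); parity.
Qed.

Lemma ext_S_multilinear h : multilin h -> S_multilinear gV gS (ext h false).
Proof.
move=> hm s1 x s2 e p u hu es.
by rewrite (ext_scale false s1 x hm hu (hseq_hparts _ es)) add0n.
Qed.

Lemma ext_ten1 h (l : seq V) : multilin h -> ext h false [seq ten v 1 | v <- l] = h l.
Proof.
elim: l h => [|v l IH] h hm //.
rewrite map_cons ext_cons twist0 extB_ten // (extB_homog _ _ _ _ (homog1 hS)).
by rewrite tens_scale1 IH //; exact: multilin_cons.
Qed.

Lemma homog_ext h c p e (s : seq T) : multilin h ->
  (forall e' l, size l = size s -> hseq gV e' l -> homog gT (p (+) odd (deg e')) (h l)) ->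
  hseq gT e s -> homog gT (p (+) odd (deg e)) (ext h c s).
Proof.
move=> hm; elim: s e h c p hm => [|x s IH] [|e0 e] h c p hm hh; try by move=> /hseq_size.
  by move=> _; exact: (hh [::] [::]).
move=> /hseq_cons [hx hs]; rewrite ext_cons (twist_homog _ hx).
have {}hh e' l : size l = (size s).+1 -> hseq gV e' l ->
  homog gT (p (+) odd (deg e')) (h l) := hh e' l.
rewrite ext_liftZ //; apply: homogZ.
move: x hx; apply: tens_homog_ind => [|x y hx hy|r v u hv hu].
- by rewrite ext_lift0 //; exact: homog0.
- by rewrite ext_liftD //; exact: homogD.
rewrite extB_ten // (extB_homog _ _ _ _ hu).
have -> : p (+) odd (deg (e0 :: e)) = (p (+) r (+) odd (deg e)) (+) (e0 (+) r).
  rewrite /= oddD oddb -/(deg e); clear.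
  by case: p; case: e0; case: r; case: (odd _).
apply: (homog_scale hS _ hu); apply: IH => //; first exact: multilin_cons.
move=> e' l sl hl.
have -> : p (+) r (+) odd (deg e') = p (+) odd (deg (r :: e')).
  by rewrite /= oddD oddb addbA.
by apply: hh; [rewrite /= sl | apply/hseq_cons].
Qed.

(** On pure tensors, antisymmetry of [h] exchanges the vectors and graded commutativity of S
    exchanges the scalars; the mixed signs come from scalars crossing vectors. *)
Lemma ext_antisym h c : multilin h ->
  (forall l1 l2 p q x y, homog gV p x -> homog gV q y ->
    h (l1 ++ x :: y :: l2) = - ((-1) ^+ (p * q)) *: h (l1 ++ y :: x :: l2)) ->
  graded_antisym gT (ext h c).
Proof.
move=> hm ha s1 s2 p q; elim: s1 h c hm ha => [|z s1 IH] h c hm ha x y hx hy; last first.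
  rewrite !cat_cons !ext_cons /tens_lift scaler_sumr; apply: eq_bigr => j _.
  rewrite /extB scaler_sumr; apply: eq_bigr => r _.
  rewrite (IH _ _ _ _ x y hx hy) ?tens_scaleZl //; first exact: multilin_cons.
  by move=> t1 t2 p' q' x' y' hx' hy'; rewrite -!cat_cons; exact: ha.
have el := ext_multilinear c hm.
rewrite !cat0s; move: x hx; apply: tens_homog_ind => [|x x' hx hx'|r v u hv hu].
- rewrite (multilinear_seq0 [::]) // (multilinear_seq0 [:: y]) // ?scaler0 //.
- have D t1 t2 a b : ext h c (t1 ++ (a + b) :: t2) = ext h c (t1 ++ a :: t2) + ext h c (t1 ++ b :: t2).
    by rewrite -[a]scale1r el !scale1r.
  by rewrite (D [::]) (D [:: y]) hx hx' scalerDr.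
move: y hy; apply: tens_homog_ind => [|y y' hy hy'|r' w z hw hz].
- rewrite (multilinear_seq0 [:: _]) // (multilinear_seq0 [::]) // ?scaler0 //.
- have D t1 t2 a b : ext h c (t1 ++ (a + b) :: t2) = ext h c (t1 ++ a :: t2) + ext h c (t1 ++ b :: t2).
    by rewrite -[a]scale1r el !scale1r.
  by rewrite (D [::]) (D [:: _]) hy hy' scalerDr.
(* Scalars leave to the right, so that of the first argument is the outermost. *)
have step c' r1 r2 v1 v2 (u1 u2 : S) q1 q2 : homog gV r1 v1 -> homog gV r2 v2 ->
    homog gS q1 u1 -> homog gS q2 u2 ->
    ext h c' [:: ten v1 u1, ten v2 u2 & s2] =
    (-1) ^+ (c' * (r1 (+) q1) + (c' (+) q1) * (r2 (+) q2)) *: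
      tens_scale (tens_scale (ext (fun l => h [:: v1, v2 & l]) (c' (+) q1 (+) q2) s2) u2) u1.
  move=> hv1 hv2 hu1 hu2.
  rewrite ext_cons (twist_homog _ (homog_ten hv1 hu1)).
  rewrite ext_liftZ // extB_ten // (extB_homog _ _ _ _ hu1).
  have hm1 := multilin_cons v1 hm.
  rewrite ext_cons (twist_homog _ (homog_ten hv2 hu2)).
  rewrite ext_liftZ // extB_ten // (extB_homog _ _ _ _ hu2).
  by rewrite tens_scaleZl scalerA -exprD.
rewrite (step _ _ _ _ _ _ _ _ _ hv hw hu hz) (step _ _ _ _ _ _ _ _ _ hw hv hz hu).
have -> : (fun l => h [:: v, w & l]) =
    (fun l => (- (-1) ^+ (r * r')) *: h [:: w, v & l]).
  by apply/funext => l; exact: (ha [::] l r r' v w hv hw).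
rewrite (ext_scalel _ (fun l => h [:: w, v & l])) !tens_scaleZl !scaleNr scalerN.
rewrite (tens_scaleC hS _ hz hu) !scalerA -!exprD addbAC; congr (- (_ *: _)); parity.
Qed.

End Extension.

Lemma big_option (V : nmodType) (I : finType) (F : option I -> V) :
  \sum_i F i = F None + \sum_i F (Some i).
Proof.
rewrite (bigD1 None) //=; congr (_ + _).
rewrite (reindex_omap Some id) => [|[i|]] //=.
by apply: eq_bigl => i; rewrite eqxx.
Qed.

Lemma bracket_linearl (k : fieldType) (V : lmodType k) (gV : z2grading V) t c
    (f f' g : seq V -> V) : multilinear_seq g ->
  bracket gV t (c *: f + f') g = c *: bracket gV t f g + bracket gV t f' g.
Proof.
move=> gl; apply/funext => s; rewrite /bracket !fctE /=.
do 4 ![rewrite scaler_sumr -big_split /=; apply: eq_bigr => ? _].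
rewrite /hbracket hcomp_linear insert_linearl insert_linearr; last first.
  exact: hcomp_multilinear.
rewrite [c *: (_ *: _)]scalerA [c * _]mulrC -[(_ * c) *: _]scalerA -scalerDr.
congr (_ *: _); rewrite scalerBr scalerDr !scalerA [c * _]mulrC.
by rewrite opprD addrACA.
Qed.

(** * Reduction modulo the maximal ideal *)

Section Augmentation.
Variables (k : fieldType) (V : lmodType k) (gV : z2grading V).
Variables (S : falgType k) (gS : z2grading S) (hS : graded_commutative gS).
Variable eps : {lrmorphism S -> k^o}.
Local Notation T := (tens V S).
Hypothesis eps_odd : forall u, homog gS true u -> eps u = 0.

Lemma contract_scale (x : T) u : contract eps (tens_scale x u) = (eps u : k) *: contract eps x.
Proof.
elim/tens_ind: x => [|x y hx hy|v w].
- by rewrite tens_scale0l linear0 scaler0.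
- by rewrite tens_scaleDl !contractD hx hy scalerDr.
- by rewrite tens_scale_ten !contract_ten rmorphM scalerA mulrC.
Qed.

(** Since [eps] is multiplicative and kills odd scalars, no sign of the extension survives the
    reduction. *)
Lemma contract_ext h (s : seq (V * S)) : multilin h ->
  contract eps (ext gV gS h false [seq ten u.1 u.2 | u <- s]) =
    (eps (\prod_(u <- s) u.2) : k) *: contract eps (h [seq u.1 | u <- s]).
Proof.
elim: s h => [|[v u] s IH] h hm.
  by rewrite big_nil rmorph1 scale1r.
rewrite map_cons ext_cons twist0 extB_ten // /extB big_bool /= contractD !contract_scale.
rewrite (eps_odd (homog_gpart gS true u)) scale0r add0r IH; last exact: multilin_cons.
rewrite scalerA big_cons rmorphM /=; congr ((_ * _) *: _).
by rewrite -[in RHS](gpart_sum gS u) raddfD /= (eps_odd (homog_gpart gS true u)) addr0.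
Qed.

End Augmentation.

(** * The Maurer-Cartan and Massey equations *)

Section AugmentedBasis.
Variables (k : fieldType) (hk : 2%N \notin [pchar k]).
Variables (S : falgType k) (gS : z2grading S) (hS : graded_commutative gS).
Variables (m : {vspace S}) (eps : {lrmorphism S -> k^o}).
Hypothesis heps : forall s, (s \in m) = (eps s == 0).
Variables (N : nat) (b : N.-tuple (subvs_of m)) (p : 'I_N -> bool).
Hypothesis hb : homog_basis gS b p.

Lemma two_neq0 : (2%:R : k) != 0.
Proof. by move: hk; rewrite inE. Qed.

(** An odd [u] satisfies u^2 = -u^2, so u^2 = 0 outside characteristic 2, and its image in the field
    is nilpotent. *)
Lemma eps_odd u : homog gS true u -> eps u = 0.
Proof.
move=> hu; have /eqP := gmulC hS hu hu.
rewrite expr1 scaleN1r -addr_eq0 -mulr2n -scaler_nat scaler_eq0 (negPf two_neq0) /=.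
move=> /eqP /(congr1 eps); rewrite rmorphM rmorph0 => /eqP.
by rewrite mulf_eq0 orbb => /eqP.
Qed.

Local Notation I := (option 'I_N).

(* The basis of S formed by 1 (index None) and the basis b of m. *)
Definition augM (i : I) : S := if i is Some j then vsval (tnth b j) else 1.
Definition augp (i : I) : bool := if i is Some j then p j else false.
(** Subtracting [eps u] first puts the element into m, where [vsproj] loses nothing. *)
Definition augC_fun (i : I) (u : S) : k^o :=
  if i is Some j then coord b j (vsproj m (u - (eps u : k) *: 1)) else eps u.

Lemma augC_linear i : linear (augC_fun i).
Proof.
case: i => [j|] c x y; rewrite /augC_fun; last exact: linearP.
have -> : c *: x + y - (eps (c *: x + y) : k) *: 1 =
    c *: (x - (eps x : k) *: 1) + (y - (eps y : k) *: 1).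
  by rewrite linearP scalerDl scalerBr scalerA opprD addrACA.
by rewrite !linearP.
Qed.
HB.instance Definition _ i :=
  GRing.isLinear.Build k S k^o *:%R (augC_fun i) (augC_linear i).
Definition augC (i : I) : {linear S -> k^o} := augC_fun i.
Arguments augC : simpl never.

Lemma eps_basis j : eps (vsval (tnth b j)) = 0.
Proof. by apply/eqP; rewrite -heps subvsP. Qed.

Lemma vsproj_basis j : vsproj m (vsval (tnth b j)) = tnth b j.
Proof. by apply: val_inj; rewrite /= vsprojK // subvsP. Qed.

Lemma coord_basis_tnth i j : coord b i (tnth b j) = (i == j)%:R.
Proof.
have [bb _] := hb; by rewrite (tnth_nth 0) coord_free ?(basis_free bb) 1?eq_sym.
Qed.

Lemma augCM i j : augC i (augM j) = (i == j)%:R.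
Proof.
rewrite /augC /augC_fun /augM /=; case: i j => [i|] [j|] /=.
- by rewrite eps_basis scale0r subr0 vsproj_basis coord_basis_tnth.
- by rewrite rmorph1 scale1r subrr !linear0.
- by rewrite eps_basis.
- by rewrite rmorph1.
Qed.

Lemma augC_m j u : u \in m -> augC (Some j) u = coord b j (vsproj m u).
Proof. by rewrite heps /augC /= /augC_fun => /eqP ->; rewrite scale0r subr0. Qed.

Lemma sum_augCM u : u = \sum_i (augC i u : k) *: augM i.
Proof.
rewrite big_option /= /augC_fun -[LHS](subrK ((eps u : k) *: 1)) addrC.
congr (_ + _); set w := _ - _.
have wm : w \in m.
  by rewrite heps /w linearB linearZ /= rmorph1 -[_ *: _]/(_ * _) mulr1 subrr.
rewrite -{1}(vsprojK wm) {1}(coord_basis hb.1 (memvf (vsproj m w))) linear_sum.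
apply: eq_bigr => i _; rewrite (tnth_nth 0).
by [].
Qed.

Lemma homog_augM i : homog gS (augp i) (augM i).
Proof. by case: i => [i|] /=; [exact: hb.2 | exact: homog1]. Qed.

Lemma augC_mulM_homog i j l :
  augC l (augM i * augM j) != 0 -> augp l = augp i (+) augp j.
Proof.
move=> Cl; apply/eqP; rewrite eq_sym; apply: contraNT Cl => ne.
by rewrite (coord_homog augCM sum_augCM homog_augM
  (homogM hS (homog_augM i) (homog_augM j)) ne).
Qed.

Lemma augC_None_mulM i j : augC None (augM i * augM j) = ((i == None) && (j == None))%:R.
Proof.
rewrite /augC /= rmorphM; case: i j => [i|] [j|] /=;
  by rewrite ?rmorph1 ?eps_basis ?mul0r ?mulr0 ?mul1r.
Qed.

Lemma augC_struct_const i j l :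
  augC (Some l) (augM (Some i) * augM (Some j)) = struct_const b i j l.
Proof. by rewrite augC_m // heps rmorphM /= !eps_basis mul0r. Qed.

Lemma dual_basisE i j : dual_basis b i (tnth b j) = (i == j)%:R.
Proof. by rewrite lfunE /= coord_basis_tnth. Qed.

Lemma dual_part_basis q (f : dual m) j :
  dual_part gS q f (tnth b j) = if q == p j then f (tnth b j) else 0.
Proof.
rewrite dual_partE (gpart_homog _ (hb.2 j)); case: ifP => _; last by rewrite !linear0.
by rewrite vsproj_basis.
Qed.

Lemma dual_ext (f g : dual m) : (forall j, f (tnth b j) = g (tnth b j)) -> f = g.
Proof.
move=> fg; apply/lfunP => x; rewrite (coord_basis hb.1 (memvf x)) !linear_sum.
by apply: eq_bigr => j _; rewrite !linearZ /= -tnth_nth fg.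
Qed.

Lemma dual_sum (f : dual m) : f = \sum_j (f (tnth b j) : k) *: dual_basis b j.
Proof.
apply: dual_ext => i; rewrite sum_lfunE (bigD1 i) //= big1 ?addr0.
  by rewrite scale_lfunE dual_basisE eqxx -[_ *: _]/(_ * _) mulr1.
by move=> j /negPf ji; rewrite scale_lfunE dual_basisE ji scaler0.
Qed.

Lemma dual_part_dual_basis q i :
  dual_part gS q (dual_basis b i) = (q == p i)%:R *: dual_basis b i.
Proof.
apply: dual_ext => j; rewrite dual_part_basis scale_lfunE !dual_basisE.
have [->|_] := eqVneq i j; first by case: eqP => _; rewrite ?scale1r ?scale0r.
by rewrite scaler0; case: ifP.
Qed.

Lemma comult_dual_basis i : comult b p (dual_basis b i) = comult_basis b p i.
Proof.
rewrite /comult (bigD1 i) //= big1 ?addr0 => [|j ji].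
  by rewrite dual_basisE eqxx scale1r.
by rewrite dual_basisE eq_sym (negPf ji) scale0r.
Qed.

End AugmentedBasis.

Section CochainFacts.
Variables (k : fieldType) (V : lmodType k) (gV : z2grading V) (t : inf_type).

Lemma cochain_nil (f : cochains gV t) : f [::] = 0.
Proof. by have /asboolP [] := cochain_funP f. Qed.

Lemma cochain_multilinear (f : cochains gV t) : multilinear_seq f.
Proof. by have /asboolP [] := cochain_funP f. Qed.

Lemma cochain_antisym (f : cochains gV t) : t = Linf -> graded_antisym gV f.
Proof. by have /asboolP [] := cochain_funP f. Qed.

Lemma cochain_ext (f g : cochains gV t) : (f : seq V -> V) = g -> f = g.
Proof. exact: val_inj. Qed.

Lemma cochain_linearP (U : lmodType k) (A : {linear U -> cochains gV t}) c x y :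
  A (c *: x + y) = c *: (A x : seq V -> V) + A y :> (seq V -> V).
Proof. by rewrite linearP. Qed.

Lemma cochain_sumE (I : Type) (r : seq I) (c : I -> k) (F : I -> cochains gV t) s :
  (\sum_(i <- r) c i *: F i) s = \sum_(i <- r) c i *: F i s.
Proof. by elim/big_rec2: _ => // i y x _ <-. Qed.

Lemma circZ Q c c' (f g : seq V -> V) e s n : multilinear_seq f ->
  size e = n -> size s = n ->
  circ t Q (c *: f) (c' *: g) e s = (c * c') *: circ t Q f g e s.
Proof.
move=> fl en sn; rewrite !(@circE _ _ _ n) // !scaler_sumr; apply: eq_bigr => i _.
rewrite !scaler_sumr; apply: eq_bigr => sigma _.
rewrite !scaler_sumr; apply: eq_bigr => j _.
by rewrite /comp_at !fctE /= multilinear_seqZ // !scalerA mulrC.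
Qed.

Lemma parityZ p c (f : seq V -> V) : has_parity gV p f -> has_parity gV p (c *: f).
Proof. by move=> fp e s es; rewrite fctE; apply: homogZ; exact: fp. Qed.

Lemma multilinearZ c (f : seq V -> V) : multilinear_seq f -> multilinear_seq (c *: f).
Proof.
by move=> fl s1 s2 a x y; rewrite !fctE /= fl scalerDr !scalerA (mulrC c).
Qed.

End CochainFacts.

Lemma bracket0l (k : fieldType) (V : lmodType k) (gV : z2grading V) t (g : seq V -> V) :
  multilinear_seq g -> bracket gV t 0 g = 0.
Proof.
move=> gl; have := bracket_linearl gV t 1 0 0 gl; rewrite !scale1r addr0.
by move=> /esym/eqP; rewrite -subr_eq0 addrK => /eqP.
Qed.

Lemma bracketZr (k : fieldType) (V : lmodType k) (gV : z2grading V) t c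
    (f g : seq V -> V) : multilinear_seq f ->
  bracket gV t f (c *: g) = c *: bracket gV t f g.
Proof.
move=> fl; have B0 : bracket gV t f 0 = 0.
  have := bracket_linearr gV t 1 0 0 fl; rewrite !scale1r addr0.
  by move=> /esym/eqP; rewrite -subr_eq0 addrK => /eqP.
by rewrite -[c *: g]addr0 bracket_linearr // B0 addr0.
Qed.

Section MaurerCartan.
Variables (k : fieldType) (hk : 2%N \notin [pchar k]).
Variables (t : inf_type) (V : lmodType k) (gV : z2grading V).
Variables (S : falgType k) (gS : z2grading S) (hS : graded_commutative gS).
Variables (m : {vspace S}) (eps : {lrmorphism S -> k^o}).
Hypothesis heps : forall s, (s \in m) = (eps s == 0).
Variables (N : nat) (b : N.-tuple (subvs_of m)) (p : 'I_N -> bool).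
Hypothesis hb : homog_basis gS b p.
Local Notation I := (option 'I_N).
Local Notation T := (tens V S).
Local Notation gT := (tens_grading gV gS).
Local Notation M := (augM b).
Local Notation C := (augC eps b).
Local Notation pI := (augp p).

Let CM := augCM heps hb.
Let sumCM := sum_augCM heps hb.
Let homogMI := homog_augM hS hb.

(* Up to sign, the coefficient of M K in tau o tau at arguments v (x) 1. *)
Definition mc (al : I -> seq V -> V) (K : I) e s : V :=
  \sum_l \sum_i ((-1) ^+ (pI i + pI l * pI i) * (C K (M l * M i) : k)) *:
    circ t (~~ pI i) (al l) (al i) e s.

Section Equation.
Variables (tau : seq T -> T) (al : I -> seq V -> V).
Hypotheses (taul : multilinear_seq tau) (taup : has_parity gT true tau).
Hypothesis tauS : S_multilinear gV gS tau.
Hypotheses (alm : forall i, multilinear_seq (al i))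
  (alp : forall i, has_parity gV (~~ pI i) (al i)).
Hypothesis tau_ten1 : forall s,
  tau [seq ten v 1 | v <- s] = \sum_i ten (twist gV (pI i) (al i s)) (M i).

Lemma contract_circ K e s : hseq gV e s ->
  contract (C K) (circ t true tau tau e [seq ten v 1 | v <- s]) =
    (-1) ^+ (pI K * (deg e + size s)) *: mc al K e s.
Proof.
move=> hs; rewrite (circ_ten1 hS homogMI t taul tauS alp tau_ten1 hs).
rewrite /mc linear_sum scaler_sumr; apply: eq_bigr => l _.
rewrite linear_sum scaler_sumr; apply: eq_bigr => i _.
rewrite -[LHS]/(contract (C K) (_ *: _)) contractZ contract_ten !scalerA; congr (_ *: _).
have [->|C0] := eqVneq (C K (M l * M i)) 0; first by rewrite !mulr0.
rewrite (augC_mulM_homog hS heps hb C0) mulrA -exprD; congr (_ * _).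
by move: (pI l) (pI i) => x y; parity.
Qed.

Lemma bracket_self (U : lmodType k) (gU : z2grading U) (f : seq U -> U) e s :
  multilinear_seq f -> has_parity gU true f -> hseq gU e s ->
  bracket gU t f f s = 2%:R *: circ t true f f e s.
Proof.
move=> fl fp hs; rewrite (bracket_hseq t fl fl fp fp hs) expr1 scaleN1r opprK.
by rewrite -mulr2n scaler_nat.
Qed.

(** As [tau] is odd, {tau, tau} is twice its square, and 2 is invertible. Coordinates of the square
    on arguments v (x) 1 are the [mc] up to sign, and [circ_vanish] extends their vanishing to all
    arguments. *)
Lemma bracket_mc : bracket gT t tau tau = 0 <->
  forall K e s, hseq gV e s -> mc al K e s = 0.
Proof.
split=> [br K e s hs|mc0].
  have : bracket gT t tau tau [seq ten v 1 | v <- s] = 0 by rewrite br.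
  rewrite (bracket_self taul taup (hseq_ten1 hS hs)) => /eqP.
  rewrite scaler_eq0 (negPf (two_neq0 hk)) /= => /eqP c0.
  have := contract_circ K hs; rewrite c0 linear0 => /esym/eqP.
  by rewrite scaler_eq0 signr_eq0 => /eqP.
apply/funext => s; rewrite (bracket_circ t s taul taul taup taup) big1 // => e _.
rewrite (circ_vanish hS taul taup tauS) ?scaler0 ?subr0 //.
  move=> e' s' hs; rewrite [LHS](sum_contract sumCM) big1 // => K _.
  by rewrite contract_circ // mc0 // scaler0 ten0l.
exact/hseq_hparts/size_tuple.
Qed.

End Equation.

Variable d : cochains gV t.
Hypothesis hd : inf_structure d.

(** A product of basis elements has a component along 1 only if both are 1, which leaves the square
    of [d]. *)
Lemma mc_None (al : I -> seq V -> V) e s : al None = d -> hseq gV e s -> mc al None e s = 0.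
Proof.
move=> al0 hs; rewrite /mc big_option big_option.
rewrite [X in _ + X + _]big1 ?addr0 => [|i _]; last first.
  by rewrite (augC_None_mulM heps) mulr0 scale0r.
rewrite [X in _ + X]big1 ?addr0 => [|l _]; last first.
  by rewrite big1 // => i _; rewrite (augC_None_mulM heps) mulr0 scale0r.
have /eqP := bracket_self (@cochain_multilinear _ _ _ _ d) hd.1 hs.
rewrite hd.2 eq_sym scaler_eq0 (negPf (two_neq0 hk)) /= al0 => /eqP ->.
by rewrite scaler0.
Qed.

(** The terms with exactly one factor 1 are the two halves of {d, al_j}; those with both factors in
    m carry the structure constants. *)
Lemma mc_Some (al : I -> seq V -> V) j e s : al None = d -> multilinear_seq (al (Some j)) ->
  has_parity gV (~~ p j) (al (Some j)) -> hseq gV e s ->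
  mc al (Some j) e s = (-1) ^+ p j *: bracket gV t d (al (Some j)) s +
    \sum_l \sum_i ((-1) ^+ (p i + p l * p i) * struct_const b l i j) *:
      circ t (~~ p i) (al (Some l)) (al (Some i)) e s.
Proof.
move=> al0 alm alp hs; rewrite /mc big_option big_option.
have C1l i : C (Some j) (M None * M i) = (Some j == i)%:R by rewrite mul1r CM.
have C1r i : C (Some j) (M i * M None) = (Some j == i)%:R by rewrite mulr1 CM.
have C1 : C (Some j) (M None * M None) = 0 by rewrite C1l.
have C1jl : C (Some j) (M None * M (Some j)) = 1 by rewrite C1l eqxx.
have C1jr : C (Some j) (M (Some j) * M None) = 1 by rewrite C1r eqxx.
have C0l i : i != j -> C (Some j) (M None * M (Some i)) = 0.
  by move=> ij; rewrite C1l (inj_eq Some_inj) eq_sym (negPf ij).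
have C0r i : i != j -> C (Some j) (M (Some i) * M None) = 0.
  by move=> ij; rewrite C1r (inj_eq Some_inj) eq_sym (negPf ij).
rewrite C1 mulr0 scale0r add0r (bigD1 j) // C1jl [X in _ + X + _]big1 ?addr0; last first.
  by move=> i /C0l ->; rewrite mulr0 scale0r.
under [X in _ + X]eq_bigr => l _ do rewrite big_option.
rewrite [X in _ + X]big_split (bigD1 j) // C1jr.
rewrite [X in _ + (_ + X + _)]big1 ?addr0; last first.
  by move=> i /C0r ->; rewrite mulr0 scale0r.
rewrite addrA; congr (_ + _).
  rewrite (bracket_hseq t (@cochain_multilinear _ _ _ _ d) alm hd.1 alp hs) /= al0.
  rewrite scalerBr scalerA -exprD !mulr1 muln0 expr0 scale1r mul0n addn0; congr (_ + _).
  by case: (p j); rewrite /= ?expr0 ?scaleN1r ?opprK // expr2 mulN1r opprK scale1r.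
apply: eq_bigr => l _; apply: eq_bigr => i _.
by rewrite (augC_struct_const heps).
Qed.

Variable A : {linear dual m -> cochains gV t}.
Hypothesis Ap : forall j, has_parity gV (~~ p j) (A (dual_basis b j)).
Local Notation Ab j := (A (dual_basis b j)).

Lemma dual_part_linear q : linear (@dual_part _ _ gS m q).
Proof.
move=> c f g; apply/lfunP => x.
by rewrite !(add_lfunE, scale_lfunE) !dual_partE !(add_lfunE, scale_lfunE).
Qed.

Lemma mu_bil_l (y : dual m) : linear (fun x : dual m => \sum_(q : bool)
  (-1) ^+ q *: bracket gV t (A (dual_part gS q x)) (A y)).
Proof.
move=> c x x'; rewrite scaler_sumr -big_split; apply: eq_bigr => q _ /=.
rewrite dual_part_linear cochain_linearP.
rewrite bracket_linearl; last exact: cochain_multilinear.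
by rewrite scalerDr !scalerA mulrC.
Qed.

Lemma mu_bil_r (x : dual m) : linear (fun y : dual m => \sum_(q : bool)
  (-1) ^+ q *: bracket gV t (A (dual_part gS q x)) (A y)).
Proof.
move=> c y y'; rewrite scaler_sumr -big_split; apply: eq_bigr => q _ /=.
rewrite cochain_linearP.
rewrite bracket_linearr; last exact: cochain_multilinear.
by rewrite scalerDr !scalerA mulrC.
Qed.

Lemma mu_tens_linear : linear (mu_tens gS A).
Proof. exact: (tens_lift_linear mu_bil_l). Qed.
HB.instance Definition _ := GRing.isLinear.Build k (tens (dual m) (dual m))
  (seq V -> V) *:%R (mu_tens gS A) mu_tens_linear.

Lemma mu_tens_ten x y : mu_tens gS A (ten x y) = \sum_(q : bool)
  (-1) ^+ q *: bracket gV t (A (dual_part gS q x)) (A y).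
Proof. exact: (tens_liftE mu_bil_l mu_bil_r). Qed.

Lemma mu_tens_comult (f : dual m) : mu_tens gS A (comult b p f) =
  \sum_j (f (tnth b j) : k) *: mu_tens gS A (comult_basis b p j).
Proof. by rewrite linear_sum; apply: eq_bigr => j _; rewrite linearZ. Qed.

Lemma mu_tens_basis j : mu_tens gS A (comult_basis b p j) =
  \sum_l \sum_i ((-1) ^+ (p l + p l * p i) * struct_const b l i j) *:
    bracket gV t (Ab l) (Ab i).
Proof.
rewrite linear_sum; apply: eq_bigr => l _; rewrite linear_sum; apply: eq_bigr => i _.
rewrite linearZ /= mu_tens_ten (bigD1 (p l)) //= big1 ?addr0; last first.
  move=> q /negPf ql; rewrite (dual_part_dual_basis hb) ql scale0r linear0.
  by rewrite (bracket0l gV t (cochain_multilinear _)) scaler0.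
rewrite (dual_part_dual_basis hb) eqxx scale1r scalerA; congr (_ *: _).
by rewrite mulrAC -exprD addnC.
Qed.

Lemma struct_constC i l j :
  struct_const b l i j = (-1) ^+ (p i * p l) * struct_const b i l j.
Proof.
rewrite -!(augC_struct_const heps) (gmulC hS (homogMI (Some l)) (homogMI (Some i))).
by rewrite linearZ mulnC.
Qed.

(** By graded commutativity of m, exchanging [l] and [i] identifies the two halves of the
    commutators, whence the factor 2. *)
Lemma mu_tens_circ j e s : hseq gV e s -> mu_tens gS A (comult_basis b p j) s =
  2%:R *: \sum_l \sum_i ((-1) ^+ (p l + p l * p i) * struct_const b l i j) *:
    circ t (~~ p i) (Ab l) (Ab i) e s.
Proof.
move=> hs; rewrite mu_tens_basis scaler_nat mulr2n.
have Am i : multilinear_seq (Ab i) := cochain_multilinear _.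
rewrite [X in _ = _ + X]exchange_big -big_split fct_sumE; apply: eq_bigr => l _ /=.
rewrite -big_split fct_sumE; apply: eq_bigr => i _ /=.
rewrite !fctE (bracket_hseq t (Am l) (Am i) (Ap l) (Ap i) hs) scalerBr; congr (_ + _).
rewrite scalerA -scaleNr (struct_constC l i); congr (_ *: _).
rewrite mulrA -exprD mulrAC -mulNr -exprD; congr (_ * _).
rewrite -mulN1r -exprS; move: (p l) (p i) => x y; parity.
Qed.

(** The factor -2 is the one that makes the linear and quadratic parts proportional to the Massey
    equation: the quadratic part scales by 4, which is (-2) times the -2 coming from
    [mu_tens_circ]. *)
Lemma mc_massey (al : I -> seq V -> V) j e s : al None = d ->
  (forall i, al (Some i) = - 2%:R *: (Ab i : seq V -> V)) -> hseq gV e s ->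
  mc al (Some j) e s = ((-1) ^+ p j * - 2%:R) *:
    (delta d (Ab j) s - mu_tens gS A (comult_basis b p j) s).
Proof.
move=> al0 alA hs; have Am i : multilinear_seq (Ab i) := cochain_multilinear _.
rewrite (mc_Some al0 _ _ hs) alA; [|exact: multilinearZ|exact: parityZ].
rewrite scalerBr (mu_tens_circ j hs); congr (_ + _).
  by rewrite -scalerA /delta bracketZr //; exact: cochain_multilinear.
rewrite -scaleNr scalerA !scaler_sumr; apply: eq_bigr => l _.
rewrite !scaler_sumr; apply: eq_bigr => i _.
rewrite !alA (@circZ _ _ t _ _ _ _ _ _ _ _ (Am l) (hseq_size hs) erefl) !scalerA; congr (_ *: _).
have [->|C0] := eqVneq (struct_const b l i j) 0; first by rewrite !(mulr0, mul0r).
(* A nonzero structure constant forces the degree of m_j to be the sum of the other two, which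
   reconciles the two sign conventions. *)
have := augC_mulM_homog hS heps hb (i := Some l) (j := Some i) (l := Some j).
rewrite (augC_struct_const heps) => /(_ C0) /= ->.
have -> : (-1) ^+ (p i + p l * p i) =
    (-1) ^+ (p l (+) p i) * (-1) ^+ (p l + p l * p i) :> k.
  by rewrite -exprD; move: (p l) (p i) => x y; parity.
move: (_ ^+ (p l (+) p i)) (_ ^+ (p l + _)) (struct_const _ _ _ _).
by clear=> x y z; ring.
Qed.

Lemma mu_tens_hparts j s : mu_tens gS A (comult_basis b p j) s =
  \sum_(e : (size s).-tuple bool) mu_tens gS A (comult_basis b p j) (hparts gV e s).
Proof.
have Am i : multilinear_seq (Ab i) := cochain_multilinear _.
rewrite !mu_tens_basis.
under [RHS]eq_bigr => e _ do rewrite fct_sumE.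
rewrite fct_sumE [RHS]exchange_big; apply: eq_bigr => l _ /=.
under [RHS]eq_bigr => e _ do rewrite fct_sumE.
rewrite fct_sumE [RHS]exchange_big; apply: eq_bigr => i _ /=.
by rewrite !fctE (bracket_hparts t s (Am l) (Am i) (Ap l) (Ap i)) scaler_sumr.
Qed.

(** Both sides are combinations of brackets of cochains of definite parity, hence determined by
    homogeneous arguments. *)
Lemma massey_hseq j :
  (forall e s, hseq gV e s -> delta d (Ab j) s = mu_tens gS A (comult_basis b p j) s) ->
  delta d (Ab j) = mu_tens gS A (comult_basis b p j).
Proof.
move=> h; apply/funext => s; rewrite mu_tens_hparts /delta.
rewrite (bracket_hparts t s (@cochain_multilinear _ _ _ _ d) (@cochain_multilinear _ _ _ _ (Ab j))
  hd.1 (Ap j)).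
by apply: eq_bigr => e _; apply: (h e); exact/hseq_hparts/size_tuple.
Qed.

End MaurerCartan.

(** * Deformations versus solutions of the Massey equation *)

Section Correspondence.
Variables (k : fieldType) (hk : 2%N \notin [pchar k]).
Variables (t : inf_type) (V : lmodType k) (gV : z2grading V).
Variables (d : cochains gV t) (hd : inf_structure d).
Variables (S : falgType k) (gS : z2grading S) (hS : graded_commutative gS).
Variables (m : {vspace S}) (eps : {lrmorphism S -> k^o}).
Hypothesis heps : forall s, (s \in m) = (eps s == 0).
Variables (N : nat) (b : N.-tuple (subvs_of m)) (p : 'I_N -> bool).
Hypothesis hb : homog_basis gS b p.
Local Notation I := (option 'I_N).
Local Notation T := (tens V S).
Local Notation gT := (tens_grading gV gS).
Local Notation M := (augM b).
Local Notation C := (augC eps b).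
Local Notation pI := (augp p).
Local Notation db := (dual_basis b).

Let CM := augCM heps hb.
Let sumCM := sum_augCM heps hb.
Let homogMI := homog_augM hS hb.

Lemma pairing_bil_l (f : dual m) (u : S) : linear (fun v : V => pairing gV gS f v u).
Proof.
move=> c x y; rewrite /pairing scaler_sumr -big_split; apply: eq_bigr => r _ /=.
rewrite scaler_sumr -big_split; apply: eq_bigr => q _ /=.
by rewrite linearP !scalerDr !scalerA [c * _]mulrC mulrAC.
Qed.

Lemma pairing_bil_r (f : dual m) (v : V) : linear (fun u : S => pairing gV gS f v u).
Proof.
move=> c x y; rewrite /pairing scaler_sumr -big_split; apply: eq_bigr => r _ /=.
rewrite scaler_sumr -big_split; apply: eq_bigr => q _ /=.
by rewrite !linearP scalerDl scalerDr !scalerA [c * _]mulrC !mulrA.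
Qed.

Lemma pairing_basis (f : dual m) v j :
  pairing gV gS f v (vsval (tnth b j)) = (f (tnth b j) : k) *: twist gV (p j) v.
Proof.
rewrite /pairing vsproj_basis !big_bool /= !(dual_part_basis hb) /twist.
case: (p j) => /=; rewrite !(scale0r, scaler0, add0r, addr0, expr0, scale1r) scalerDr addrC //.
by rewrite expr1 !scalerA mulrC.
Qed.

Section Alpha.
Variables (tau : seq T -> T) (al : I -> seq V -> V).
Hypothesis al0 : al None = d.
Hypothesis tau_ten1 : forall s,
  tau [seq ten v 1 | v <- s] = \sum_i ten (twist gV (pI i) (al i s)) (M i).

(** The coefficient of 1 is cancelled by [d], and the sign of the pairing by the involutivity of
    [twist]. *)
Lemma alpha_basis (f : dual m) s :
  alpha d gS tau f s = \sum_j (f (tnth b j) : k) *: al (Some j) s.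
Proof.
rewrite /alpha tau_ten1 big_option /= al0 twist0 addrAC subrr add0r.
pose L : {linear T -> V} := HB.pack (tens_lift (pairing gV gS f))
  (GRing.isLinear.Build k T V *:%R _ (tens_lift_linear (pairing_bil_l f))).
rewrite -[LHS]/(L _) linear_sum; apply: eq_bigr => j _.
rewrite -[LHS]/(tens_lift (pairing gV gS f) _).
rewrite (tens_liftE (pairing_bil_l f) (pairing_bil_r f)).
by rewrite pairing_basis twistK.
Qed.

End Alpha.

Lemma deformation_massey (tau : cochains gT t) (a : {linear subvs_of (dual0 m) -> cohomology d}) :
  deformation d eps tau -> differential_of gS tau a ->
  massey_trivial gS b p ((- 2^-1) \*: a).
Proof.
move=> [[taup tauB] tauS tauE] tauD.
have taul := @cochain_multilinear _ _ _ _ tau.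
pose al i s : V := twist gV (pI i) (contract (C i) (tau [seq ten v 1 | v <- s])).
have tau1 s : tau [seq ten v 1 | v <- s] = \sum_i ten (twist gV (pI i) (al i s)) (M i).
  by rewrite {1}[LHS](sum_contract sumCM); apply: eq_bigr => i _; rewrite twistK.
have al0 : al None = d.
  apply/funext => s; rewrite /al twist0.
  (* With all scalars equal to 1, the homomorphism condition says that the coefficient of 1 is
     [d]. *)
  have := tauE [seq (v, 1) | v <- s].
  rewrite -!map_comp big_map big1 // rmorph1 scale1r [map _ s in RHS]map_id => <-.
  by [].
have alm i : multilinear_seq (al i).
  move=> s1 s2 c x y; rewrite /al !map_cat !map_cons ten_linearl taul.
  by rewrite linearP linearP.
have alp i : has_parity gV (~~ pI i) (al i).
  move=> e s es; have hs := hseq_ten1 hS (hseq_hparts gV es).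
  have := has_parity_homog taup hs; rewrite size_map size_hparts // => h.
  apply: homog_twist; have := homog_contract CM sumCM homogMI i h.
  by case: (pI i); case: (odd (size s).-1); case: (odd (deg e)).
have alC i : al i \in cochain_pred gV t.
  apply/asboolP; split; [|exact: alm|move=> tL s1 s2 q r x y hx hy].
    by rewrite /al /= cochain_nil !linear0.
  rewrite /al !map_cat !map_cons.
  rewrite (@cochain_antisym _ _ _ _ tau tL _ _ _ _ _ _ (homog_ten1 hS hx) (homog_ten1 hS hy)).
  by rewrite contractZ linearZ.
pose B i : cochains gV t := Cochains (alC (Some i)).
(* This is -1/2 times [alpha tau], as a linear map into cochains. *)
pose A (f : dual m) : cochains gV t := \sum_j (- 2^-1 * (f (tnth b j) : k)) *: B j.
have Al : linear A.
  move=> c f g; rewrite /A scaler_sumr -big_split; apply: eq_bigr => j _ /=.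
  by rewrite add_lfunE scale_lfunE mulrDr scalerDl scalerA mulrCA.
pose AL : {linear dual m -> cochains gV t} := HB.pack A (GRing.isLinear.Build _ _ _ _ A Al).
have Adb j : A (db j) = - 2^-1 *: B j.
  rewrite /A (bigD1 j) //= big1 ?addr0 => [|i ij].
    by rewrite (dual_basisE hb) eqxx mulr1.
  by rewrite (dual_basisE hb) eq_sym (negPf ij) mulr0 scale0r.
have AE f s : A f s = \sum_j (- 2^-1 * (f (tnth b j) : k)) *: al (Some j) s.
  by rewrite /A cochain_sumE.
have n2 : - 2%:R * - 2^-1 = 1 :> k by rewrite mulrNN mulfV // two_neq0.
have alA i : al (Some i) = - 2%:R *: (AL (db i) : seq V -> V).
  rewrite -[AL _]/(A _) Adb -[cochain_fun (_ *: _)]/(_ *: al (Some i)).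
  by rewrite scalerA n2 scale1r.
have ALp j : has_parity gV (~~ p j) (AL (db j)).
  by rewrite -[AL _]/(A _) Adb; apply: (parityZ (- 2^-1) (alp (Some j))).
have mc0 := (bracket_mc hk t hS heps hb taul taup tauS alp tau1).1 tauB.
have delta_db j : delta d (AL (db j)) = mu_tens gS AL (comult_basis b p j).
  apply: (massey_hseq hb hd ALp) => e s hs; apply/eqP; rewrite -subr_eq0; apply/eqP.
  have := mc_massey hS heps hb hd ALp j al0 alA hs; rewrite mc0 // => /esym/eqP.
  rewrite scaler_eq0 mulf_eq0 signr_eq0 oppr_eq0 (negPf (two_neq0 hk)) /=.
  by move/eqP.
exists AL; split.
- move=> q f fq e s es; rewrite -[AL f]/(A f) AE; apply: homog_sum => j _.
  have := dual_part_basis hb q f j; rewrite fq; case: eqP => [->|_ ->].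
    by move=> _; apply: homogZ; exact: alp.
  by rewrite mulr0 scale0r; exact: homog0.
- move=> f; rewrite mu_tens_comult.
  have -> : AL f = \sum_j (f (tnth b j) : k) *: AL (db j).
    by rewrite [in LHS](dual_sum hb f) linear_sum; apply: eq_bigr => j _; rewrite linearZ.
  by rewrite linear_sum; apply: eq_bigr => j _; rewrite linearZ /= delta_db.
- move=> f; have [z [zE za]] := tauD f; exists (- 2^-1 *: z); split.
    apply: cochain_ext; apply/funext => s.
    rewrite -[AL _]/(A _) AE -[RHS]/(- 2^-1 *: cochain_fun (cocycle_val z) s) -zE.
    rewrite (alpha_basis al0 tau1) scaler_sumr; apply: eq_bigr => j _.
    by rewrite scalerA.
  by rewrite linearZ /= za.
Qed.

Lemma massey_deformation (a : {linear subvs_of (dual0 m) -> cohomology d}) :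
  massey_trivial gS b p ((- 2^-1) \*: a) ->
  exists tau : cochains gT t, deformation d eps tau /\ differential_of gS tau a.
Proof.
move=> [A [Aparity Aeq Aa]].
have Ap j : has_parity gV (~~ p j) (A (db j)).
  by apply: Aparity; rewrite (dual_part_dual_basis hb) eqxx scale1r.
(* The components that [tau] must have for its [alpha] to be -2 times the given solution. *)
pose al (i : I) : seq V -> V :=
  if i is Some j then - 2%:R *: (A (db j) : seq V -> V) else d.
have alm i : multilinear_seq (al i).
  by case: i => [j|] /=; [apply: multilinearZ |]; exact: cochain_multilinear.
have alp i : has_parity gV (~~ pI i) (al i).
  by case: i => [j|] /=; [apply: parityZ | exact: hd.1].
have ala i : t = Linf -> graded_antisym gV (al i).
  case: i => [j|] tL s1 s2 q r x y hx hy /=; last exact: cochain_antisym hx hy.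
  rewrite !fctE /= (@cochain_antisym _ _ _ _ (A (db j)) tL _ _ _ _ _ _ hx hy).
  by rewrite !scalerA mulrC.
pose h s : T := \sum_i ten (twist gV (pI i) (al i s)) (M i).
have hm : multilin h.
  move=> s1 s2 c x y; rewrite /h scaler_sumr -big_split; apply: eq_bigr => i _.
  by rewrite alm linearP ten_linearl.
(* [h] prescribes [tau] on arguments v (x) 1; no scalar is waiting at the start, hence [false]. *)
pose f := ext gV gS h false.
have fC : f \in cochain_pred gT t.
  apply/asboolP; split; [|exact: ext_multilinear|move=> tL].
    rewrite /f /= /h big1 // => i _; have -> : al i [::] = 0.
      by case: i => [j|] /=; rewrite ?fctE /= cochain_nil ?scaler0.
    by rewrite linear0 ten0l.
  apply: ext_antisym => // s1 s2 q r x y hx hy.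
  rewrite /h scaler_sumr; apply: eq_bigr => i _.
  by rewrite (ala i tL _ _ _ _ _ _ hx hy) linearZ tenZl.
pose tau : cochains gT t := Cochains fC.
have taul : multilinear_seq tau := cochain_multilinear tau.
have tau1 s : tau [seq ten v 1 | v <- s] = \sum_i ten (twist gV (pI i) (al i s)) (M i).
  by rewrite -[RHS]/(h s) -(ext_ten1 gV hS s hm).
have tauS : S_multilinear gV gS tau by exact: ext_S_multilinear.
have taup : has_parity gT true tau.
  move=> e s es; apply: (homog_ext hS) => //; last exact: hseq_hparts.
  move=> e' l sl hl; rewrite /h; apply: homog_sum => i _.
  have hh := has_parity_homog (alp i) hl.
  have := homog_ten (homog_twist (pI i) hh) (homogMI i).
  rewrite sl size_hparts //.
  by case: (pI i); case: (odd (size s).-1); case: (odd (deg e')).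
have al0 : al None = d by [].
have tauB : bracket gT t tau tau = 0.
  apply/(bracket_mc hk t hS heps hb taul taup tauS alp tau1) => -[j|] e s hs; last first.
    by rewrite (mc_None hk heps b p hd al0 hs).
  rewrite (mc_massey hS heps hb hd Ap j al0 _ hs) // Aeq (comult_dual_basis hb).
  by rewrite subrr scaler0.
have n2 : - 2%:R * - 2^-1 = 1 :> k by rewrite mulrNN mulfV // two_neq0.
have contract_h s : contract eps (h s) = d s.
  rewrite /h (big_morph (contract eps) (contractD eps) (linear0 _)) big_option !contract_ten.
  rewrite rmorph1 scale1r twist0 big1 ?addr0 // => j _.
  by rewrite contract_ten /= (eps_basis heps) scale0r.
exists tau; split.
  split=> //; move=> s; rewrite -[LHS]/(contract eps (tau _)).
  by rewrite (contract_ext gV (eps_odd hk hS eps)) // contract_h.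
(* The cocycle [z] represents -1/2 of the class of [a], so -2 times it represents that class. *)
move=> f0; have [z [zE za]] := Aa f0; exists (- 2%:R *: z); split.
  apply/funext => s; rewrite (alpha_basis al0 tau1).
  rewrite -[RHS]/(- 2%:R *: cochain_fun (cocycle_val z) s) -zE.
  have -> : A (vsval f0) = \sum_j (vsval f0 (tnth b j) : k) *: A (db j).
    rewrite [in LHS](dual_sum hb (vsval f0)) linear_sum.
    by apply: eq_bigr => j _; rewrite linearZ.
  rewrite cochain_sumE scaler_sumr; apply: eq_bigr => j _.
  by rewrite /al fctE !scalerA mulrC.
by rewrite linearZ /= za scalerA n2 scale1r.
Qed.

End Correspondence.

Theorem theorem1 (k : fieldType) (hk : 2%N \notin [pchar k])
    (t : inf_type) (V : lmodType k) (gV : z2grading V)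
    (d : cochains gV t) (hd : inf_structure d)
    (S : falgType k) (gS : z2grading S) (hS : graded_commutative gS)
    (m : {vspace S}) (hm : maximal_ideal m)
    (eps : {lrmorphism S -> k^o}) (heps : forall s, (s \in m) = (eps s == 0))
    (N : nat) (b : N.-tuple (subvs_of m)) (p : 'I_N -> bool)
    (hb : homog_basis gS b p)
    (a : {linear subvs_of (dual0 m) -> cohomology d}) :
  (exists tau : cochains (tens_grading gV gS) t,
     deformation d eps tau /\ differential_of gS tau a)
  <-> massey_trivial gS b p ((- 2^-1) \*: a).
Proof.
split=> [[tau [tauD taua]]|aM]; first exact: (deformation_massey hk hd hS heps hb tauD taua).
exact: (massey_deformation hk hd hS heps hb aM).
Qed.
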